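(* Let $X\subset\mathbb R^m$ be compact with finite intrinsic distance $d_X$ on $X\times X$, let $f\colon X\to\mathbb R$ be continuous with $(X,f)$ a constructible $\mathbb R$-space, let $\omega_f$ be a fixed non-decreasing modulus of continuity of $f$ with respect to $d_X$, and let $R=\mathfrak R(X,f)$. Let $P$ be a probability measure with support $X$, compact in the metric $d_X$, satisfying the $(a,b)$-standard assumption in the metric $d_X$ for some $a,b>0$: $$P(B_{d_X}(x,r))\ge\min\{ar^b,1\}\qquad\text{for all }x\in X,\ r>0 .$$ Let $S_n=\{X_1,\dots,X_n\}$ be an i.i.d. sample from $P$. Then, for every $\delta>0$, $$\mathbb P\Bigl(d_I\bigl(\mathcal F_R,\mathcal R_\delta^{S_n,d_X}\bigr)\le\mu_\delta\Bigr)\ge1-\alpha_\delta,\qquad \alpha_\delta=\min\Bigl\{1,\frac{4^b}{a\delta^b}\exp\Bigl(-a\bigl(\tfrac\delta2\bigr)^bn\Bigr)\Bigr\}.$$ If $\omega_f$ is concave and $\omega_f(0)=0$, then $\mu_\delta$ can be replaced by $\omega_f(\delta)$ in this inequality; in particular, if $f$ is $1$-Lipschitz with respect to $d_X$, then $\mu_\delta$ can be replaced by $\delta$.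
   Context: **Intrinsic distance.** $d_X(x,y)$ is the infimum of the lengths (suprema of Euclidean polygonal sums) of continuous paths in $X$ from $x$ to $y$ ($+\infty$ if there is no path). When finite, it is attained by a minimizing geodesic. $B_{d_X}(x,r)$ is the closed $d_X$-ball. **Constructible $\mathbb R$-spaces.** $(X,f)$, $f\colon X\to\mathbb R$ continuous, is constructible if it is isomorphic over $\mathbb R$ to a space built from finitely many reals $a_0<\dots<a_n$, compact locally path-connected spaces $V_0,\dots,V_n$, $E_0,\dots,E_{n-1}$ and continuous maps $l_i\colon E_i\to V_i$, $r_i\colon E_i\to V_{i+1}$ as the quotient of $\bigsqcup_i V_i\times\{a_i\}\sqcup\bigsqcup_iE_i\times[a_i,a_{i+1}]$ by $(x,a_i)\sim(l_i(x),a_i)$, $(x,a_{i+1})\sim(r_i(x),a_{i+1})$, with $f$ the second projection. The Reeb graph $\mathfrak R(X,f)=(X/\!\sim_f,\bar f)$ identifies points lying in the same path component of a level set of $f$. **Cosheaves and interleaving distance.** $\mathbf{Int}$ is the poset category of open intervals of $\mathbb R$. For an $\mathbb R$-space $(Y,g)$, $\mathcal F_{(Y,g)}(I)=\pi_0(g^{-1}(I))$, with maps induced by inclusion; $\mathcal F_R$ is this functor for the Reeb graph $R$, and it is canonically isomorphic to $\mathcal F_{(X,f)}$. For $I=(a,b)$ put $I^\varepsilon=(a-\varepsilon,b+\varepsilon)$ and $\mathcal S_\varepsilon(\mathcal G)(I)=\mathcal G(I^\varepsilon)$. An $\varepsilon$-interleaving of $\mathcal F,\mathcal G$ is a pair of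 natural transformations $\varphi\colon\mathcal F\Rightarrow\mathcal S_\varepsilon\mathcal G$, $\psi\colon\mathcal G\Rightarrow\mathcal S_\varepsilon\mathcal F$ such that $\mathcal S_\varepsilon(\psi)\circ\varphi$ and $\mathcal S_\varepsilon(\varphi)\circ\psi$ are the canonical transformations induced by $I\subseteq I^{2\varepsilon}$. $d_I(\mathcal F,\mathcal G)$ is the infimum of such $\varepsilon\ge0$. **Modulus and scale.** $\omega_f\colon[0,\infty)\to[0,\infty)$ is non-decreasing with $\omega_f(0)=0$ and $|f(x)-f(y)|\le\omega_f(d_X(x,y))$ for all $x,y\in X$. For each pair $x,y$ fix a minimizing $d_X$-geodesic $\gamma_{xy}\colon[0,1]\to X$ from $x$ to $y$, parametrized proportionally to arc length. For $\delta>0$, $$\theta_f(\delta)=\sup_{x,y\in X,\ d_X(x,y)\le2\delta}\max\Bigl\{\tfrac12|f(x)-f(y)|,\ \sup_{t\in[0,1]}\bigl|f(\gamma_{xy}(t))-((1-t)f(x)+tf(y))\bigr|\Bigr\},\qquad \mu_\delta=\max\{\omega_f(\delta),\theta_f(\delta)\}.$$ **PL-Reeb estimator.** $\Gamma_\delta^{S_n,d_X}$ is the graph with vertex set $S_n$ in which distinct $x,y$ are joined by an edge iff $d_X(x,y)\le2\delta$. $\hat f_n^{d_X}$ is the extension of $f|_{S_n}$ to the geometric realization that is affine on each edge. $\mathcal R_\delta^{S_n,d_X}$ is the functor $I\mapsto\pi_0\bigl((\hat f_n^{d_X})^{-1}(I)\bigr)$. *)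

(* Defs.v *)
From HB Require Import structures.
From mathcomp Require Import all_boot all_order all_algebra generic_quotient.
From mathcomp Require Import interval_inference.
From mathcomp Require Import all_classical all_reals all_analysis.
From Stdlib Require Import Relation_Operators Operators_Properties.

Set Implicit Arguments.
Unset Strict Implicit.
Unset Printing Implicit Defensive.

Import Order.TTheory GRing.Theory Num.Theory numFieldNormedType.Exports.

Local Open Scope classical_set_scope.
Local Open Scope ring_scope.
Local Open Scope quotient_scope.

Section glue.
Context {T : topologicalType} (r : T -> T -> Prop).

Definition glue_rel (x y : T) : bool := `[< clos_refl_sym_trans T r x y >].

Fact glue_rel_refl : reflexive glue_rel.
Proof. by move=> x; apply/asboolP; exact: rst_refl. Qed.

Fact glue_rel_sym : symmetric glue_rel.
Proof.
by move=> x y; apply/asboolP/asboolP => h; exact: rst_sym.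
Qed.

Fact glue_rel_trans : transitive glue_rel.
Proof.
by move=> y x z /asboolP xy /asboolP yz; apply/asboolP; exact: rst_trans yz.
Qed.

Definition glue_equiv := EquivRel _ glue_rel_refl glue_rel_sym glue_rel_trans.

Definition glue := {eq_quot glue_equiv}.

HB.instance Definition _ := Topological.copy glue (quotient_topology glue).
HB.instance Definition _ := Quotient.on glue.

Lemma glueP (x y : T) :
  \pi_glue x = \pi_glue y :> glue <-> clos_refl_sym_trans T r x y.
Proof.
split=> [h|h]; first by apply/asboolP; exact/(@eqmodP _ glue_equiv).
by apply/(@eqmodP _ glue_equiv)/asboolP.
Qed.

Lemma repr_glue (x : T) :
  clos_refl_sym_trans T r (repr (\pi_glue x : glue)) x.
Proof. by apply/glueP; rewrite reprK. Qed.

End glue.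

Section paths.
Context {R : realType} {T : topologicalType}.

(* Paths are functions on [R]; only their restriction to [0, 1] matters. *)
Definition is_path (A : set T) (x y : T) (g : R -> T) : Prop :=
  [/\ {within `[0, 1], continuous g}, g 0 = x, g 1 = y
    & forall t, t \in `[0, 1] -> A (g t)].

Definition joined (A : set T) (x y : T) : Prop := exists g, is_path A x y g.

Definition path_connected (A : set T) : Prop :=
  A !=set0 /\ forall x y, A x -> A y -> joined A x y.

(* [joined A] is an equivalence relation on [A], hence it coincides with the
   relation it generates. *)
Definition pi0 (A : set T) : Type :=
  glue (fun x y : A => joined A (\val x) (\val y)).

End paths.

Arguments joined R {T} A x y.
Arguments path_connected R {T} A.
Arguments pi0 R {T} A.

Definition locally_path_connected (R : realType) (T : topologicalType) : Prop :=
  forall (x : T) (U : set T), open U -> U x ->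
    exists V, [/\ open V, V x, V `<=` U & path_connected R V].

Record constructible_data (R : realType) := ConstructibleData {
  cd_n : nat;
  cd_a : 'I_cd_n.+1 -> R;
  cd_a_incr : forall i j : 'I_cd_n.+1, (i < j)%N -> cd_a i < cd_a j;
  cd_V : 'I_cd_n.+1 -> topologicalType;
  cd_E : 'I_cd_n -> topologicalType;
  cd_V_compact : forall i, compact [set: cd_V i];
  cd_V_lpc : forall i, locally_path_connected R (cd_V i);
  cd_E_compact : forall i, compact [set: cd_E i];
  cd_E_lpc : forall i, locally_path_connected R (cd_E i);
  cd_l : forall i, cd_E i -> cd_V (widen_ord (leqnSn cd_n) i);
  cd_r : forall i, cd_E i -> cd_V (lift ord0 i);
  cd_l_cont : forall i, continuous (@cd_l i);
  cd_r_cont : forall i, continuous (@cd_r i)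
}.

Section constructible.
Context {R : realType} (D : constructible_data R).
Let n := cd_n D.

(* The left and right ends [i] and [i + 1] of the [i]-th strip; the value of
   [lift ord0 i] is [i.+1]. *)
Definition cd_left (i : 'I_n) : 'I_n.+1 := widen_ord (leqnSn n) i.
Definition cd_right (i : 'I_n) : 'I_n.+1 := lift ord0 i.

Definition cd_itv (i : 'I_n) : set R :=
  `[cd_a (cd_left i), cd_a (cd_right i)]%classic.

Definition cd_piece (k : 'I_n.+1 + 'I_n) : topologicalType :=
  match k with
  | inl i => (cd_V i * set_type [set cd_a i])%type
  | inr i => (cd_E i * set_type (cd_itv i))%type
  end.

Definition cd_sum := {k : 'I_n.+1 + 'I_n & cd_piece k}.

Definition cd_vertex (i : 'I_n.+1) (v : cd_V i) (t : set_type [set cd_a i])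
  : cd_sum := existT cd_piece (inl i) (v, t).

Definition cd_strip (i : 'I_n) (x : cd_E i) (t : set_type (cd_itv i))
  : cd_sum := existT cd_piece (inr i) (x, t).

Inductive cd_attach : cd_sum -> cd_sum -> Prop :=
| cd_attach_l (i : 'I_n) (x : cd_E i) (t : set_type (cd_itv i))
    (s : set_type [set cd_a (cd_left i)]) :
    \val t = cd_a (cd_left i) ->
    cd_attach (cd_strip x t) (cd_vertex (cd_l x) s)
| cd_attach_r (i : 'I_n) (x : cd_E i) (t : set_type (cd_itv i))
    (s : set_type [set cd_a (cd_right i)]) :
    \val t = cd_a (cd_right i) ->
    cd_attach (cd_strip x t) (cd_vertex (cd_r x) s).

Definition cd_height (z : cd_sum) : R :=
  match z with
  | existT (inl i) p => \val p.2
  | existT (inr i) p => \val p.2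
  end.

Definition cd_space := glue cd_attach.

End constructible.

(* [h] is a homeomorphism carrying the projection of the quotient to [f]. *)
Definition constructible (R : realType) (T : topologicalType) (f : T -> R)
    : Prop :=
  continuous f /\
  exists (D : constructible_data R) (h : cd_space D -> T) (h' : T -> cd_space D),
    [/\ continuous h, continuous h', cancel h h', cancel h' h
      & forall z : cd_sum D, f (h (\pi_(cd_space D) z)) = cd_height z].

Section reeb_graph.
Context {R : realType} {T : topologicalType} (f : T -> R).

Definition reeb_rel (x y : T) : Prop :=
  f x = f y /\ joined R (f @^-1` [set f x]) x y.

Definition reeb_graph := glue reeb_rel.

Definition reeb_fun (c : reeb_graph) : R := f (repr c).

Lemma reeb_fun_pi (x : T) : reeb_fun (\pi_reeb_graph x) = f x.
Proof.
have cst y z : clos_refl_sym_trans T reeb_rel y z -> f y = f z.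
  by elim=> [? ? []|//|? ? _ ->|? ? ? _ -> _ ->].
exact/cst/repr_glue.
Qed.

End reeb_graph.

(* Nonempty open intervals, bounded or not. *)
Record interval (R : realType) := OpenInterval {
  lo : \bar R;
  hi : \bar R;
  lo_lt_hi : (lo < hi)%E
}.

Section intervals.
Context {R : realType}.
Implicit Types (I J : interval R) (e : {nonneg R}).

Definition itv_set I : set R := [set r | (lo I < r%:E < hi I)%E].

(* For nonempty intervals this is inclusion. *)
Definition itv_le I J : bool := ((lo J <= lo I) && (hi I <= hi J))%E.

Lemma itv_le_sub I J : itv_le I J -> itv_set I `<=` itv_set J.
Proof.
move=> /andP[lJI hIJ] r /andP[lr rh]; apply/andP; split.
  exact: le_lt_trans lr.
exact: lt_le_trans hIJ.
Qed.

Lemma itv_le_refl I : itv_le I I. Proof. by rewrite /itv_le !lexx. Qed.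

Lemma itv_le_trans I J K : itv_le I J -> itv_le J K -> itv_le I K.
Proof.
move=> /andP[lJI hIJ] /andP[lKJ hJK]; apply/andP; split.
  exact: le_trans lJI.
exact: le_trans hJK.
Qed.

Lemma thicken_lo e (x : \bar R) : (x - e%:num%:E <= x)%E.
Proof. by rewrite geeDl// oppe_le0 lee_fin. Qed.

Lemma thicken_hi e (x : \bar R) : (x <= x + e%:num%:E)%E.
Proof. by rewrite leeDl// lee_fin. Qed.

Fact thicken_subproof e I : (lo I - e%:num%:E < hi I + e%:num%:E)%E.
Proof.
exact/(le_lt_trans (thicken_lo e _))/(lt_le_trans (lo_lt_hi I))/thicken_hi.
Qed.

Definition thicken e I : interval R := OpenInterval (thicken_subproof e I).

Lemma thicken_le e I J : itv_le I J -> itv_le (thicken e I) (thicken e J).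
Proof.
by move=> /andP[lJI hIJ]; apply/andP; split; [exact: leeB|exact: leeD].
Qed.

Lemma le_thicken e I : itv_le I (thicken e I).
Proof. by apply/andP; split; [exact: thicken_lo|exact: thicken_hi]. Qed.

End intervals.

Record precosheaf (R : realType) := Precosheaf {
  pc_obj :> interval R -> Type;
  pc_map : forall I J, itv_le I J -> pc_obj I -> pc_obj J;
  pc_id : forall I (h : itv_le I I) (c : pc_obj I), pc_map h c = c;
  pc_comp : forall I J K (hIJ : itv_le I J) (hJK : itv_le J K)
    (hIK : itv_le I K) (c : pc_obj I),
    pc_map hJK (pc_map hIJ c) = pc_map hIK c
}.

Record nattrans (R : realType) (F G : precosheaf R) := NatTrans {
  nt_fun :> forall I, F I -> G I;
  nt_natural : forall I J (h : itv_le I J) (c : F I),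
    nt_fun (pc_map h c) = pc_map h (nt_fun c)
}.

Section interleaving.
Context {R : realType}.
Implicit Types (F G : precosheaf R) (e : {nonneg R}).

Definition shift e F : precosheaf R :=
  @Precosheaf R (fun I => F (thicken e I))
    (fun I J h => pc_map (thicken_le e h))
    (fun I h c => pc_id _ c)
    (fun I J K hIJ hJK hIK c => pc_comp _ _ _ c).

(* [thicken e (thicken e I)] is the [2e]-thickening of [I]. *)
Definition interleaved e F G : Prop :=
  exists (phi : nattrans F (shift e G)) (psi : nattrans G (shift e F)),
    (forall I (h : itv_le I (thicken e (thicken e I))) (c : F I),
       psi (thicken e I) (phi I c) = pc_map h c) /\
    (forall I (h : itv_le I (thicken e (thicken e I))) (c : G I),
       phi (thicken e I) (psi I c) = pc_map h c).

Definition interleaving_distance F G : \bar R :=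
  ereal_inf [set e%:num%:E | e in [set e | interleaved e F G]].

End interleaving.

Section pi0_cosheaf.
Context {R : realType}.

Definition set_incl (T : Type) (A B : set T) (AB : A `<=` B) (x : A) : B :=
  exist _ (\val x) (mem_set (AB _ (set_mem (valP x)))).

Definition pi0_map (T : topologicalType) (A B : set T) (AB : A `<=` B)
  (c : pi0 R A) : pi0 R B := \pi_(pi0 R B) (set_incl AB (repr c)).

Lemma pi0_map_pi (T : topologicalType) (A B : set T) (AB : A `<=` B) (x : A) :
  pi0_map AB (\pi_(pi0 R A) x) = \pi_(pi0 R B) (set_incl AB x).
Proof.
apply/glueP.
have key y z :
    clos_refl_sym_trans A (fun x y => joined R A (\val x) (\val y)) y z ->
  clos_refl_sym_trans B (fun x y => joined R B (\val x) (\val y))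
    (set_incl AB y) (set_incl AB z).
  elim=> {y z}.
  - move=> y z [g [cg g0 g1 gA]]; apply: rst_step; exists g; split => //.
    by move=> t /gA /AB.
  - by move=> y; exact: rst_refl.
  - by move=> y z _ h; exact: rst_sym.
  - by move=> y z w _ yz _ zw; exact: rst_trans zw.
exact/key/repr_glue.
Qed.

Context {T : topologicalType} (g : T -> R).

Fact preimage_itv_sub (I J : interval R) :
  itv_le I J -> g @^-1` itv_set I `<=` g @^-1` itv_set J.
Proof. by move=> /itv_le_sub IJ; exact: preimage_subset. Qed.

Let obj (I : interval R) : Type := pi0 R (g @^-1` itv_set I).
Let map I J (h : itv_le I J) : obj I -> obj J := pi0_map (preimage_itv_sub h).

Fact pi0_cosheaf_id I (h : itv_le I I) (c : obj I) : map h c = c.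
Proof.
by rewrite -[RHS]reprK /map /pi0_map; congr (\pi_(_) _); exact: eq_sig_hprop.
Qed.

Fact pi0_cosheaf_comp I J K (hIJ : itv_le I J) (hJK : itv_le J K)
  (hIK : itv_le I K) (c : obj I) : map hJK (map hIJ c) = map hIK c.
Proof.
rewrite /map [pi0_map (preimage_itv_sub hIJ) c]/pi0_map pi0_map_pi.
by congr (\pi_(_) _); exact: eq_sig_hprop.
Qed.

Definition pi0_cosheaf : precosheaf R :=
  Precosheaf pi0_cosheaf_id pi0_cosheaf_comp.

End pi0_cosheaf.

Section intrinsic.
Context {R : realType} {m : nat}.
Local Notation V := 'rV[R]_m.

(* The library norm on row vectors is the sup norm. *)
Definition enorm (v : V) : R := Num.sqrt (\sum_(i < m) v ord0 i ^+ 2).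

Definition polygonal_sum (g : R -> V) (a b : R) (s : seq R) : R :=
  let F := g \o nth b (a :: s) in
  \sum_(0 <= k < size s) enorm (F k.+1 - F k).

Definition path_length (g : R -> V) (a b : R) : \bar R :=
  ereal_sup [set (polygonal_sum g a b s)%:E | s in itv_partition a b].

Definition intrinsic_dist (X : set V) (x y : V) : \bar R :=
  ereal_inf [set path_length g 0 1 | g in is_path X x y].

(* Contained in [X]: the distance to a point outside [X] is [+oo]. *)
Definition intrinsic_ball (X : set V) (x : V) (r : R) : set V :=
  [set y | (intrinsic_dist X x y <= r%:E)%E].

Definition intrinsic_space (X : set V) : Type := X.

HB.instance Definition _ (X : set V) := Choice.on (intrinsic_space X).

Definition intrinsic_open (X : set V) (U : set (intrinsic_space X)) : Prop :=
  forall x, U x -> exists2 e : R, 0 < e &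
    forall y, (intrinsic_dist X (\val x) (\val y) < e%:E)%E -> U y.

Fact intrinsic_openT (X : set V) : intrinsic_open [set: intrinsic_space X].
Proof. by move=> x _; exists 1. Qed.

Fact intrinsic_openI (X : set V) (A B : set (intrinsic_space X)) :
  intrinsic_open A -> intrinsic_open B -> intrinsic_open (A `&` B).
Proof.
move=> oA oB x [Ax Bx].
have [a a0 aA] := oA _ Ax; have [b b0 bB] := oB _ Bx.
exists (Num.min a b); first by rewrite lt_min a0.
by move=> y; rewrite EFin_min lt_min => /andP[/aA Ay /bB By].
Qed.

Fact intrinsic_open_bigU (X : set V) (I : Type)
    (F : I -> set (intrinsic_space X)) :
  (forall i, intrinsic_open (F i)) -> intrinsic_open (\bigcup_i F i).
Proof.
move=> oF x [i _ Fix]; have [e e0 eF] := oF i _ Fix.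
by exists e => // y /eF Fy; exists i.
Qed.

HB.instance Definition _ (X : set V) :=
  isOpenTopological.Build (intrinsic_space X)
    (@intrinsic_openT X) (@intrinsic_openI X) (@intrinsic_open_bigU X).

Definition intrinsic_finite (X : set V) : Prop :=
  forall x y, X x -> X y -> intrinsic_dist X x y \is a fin_num.

Definition intrinsic_compact (X : set V) : Prop :=
  compact [set: intrinsic_space X].

(* A minimizing geodesic, parametrized proportionally to arc length. *)
Definition is_geodesic (X : set V) (x y : V) (g : R -> V) : Prop :=
  [/\ is_path X x y g,
      path_length g 0 1 = intrinsic_dist X x y &
      forall s t, 0 <= s -> s <= t -> t <= 1 ->
        path_length g s t = ((t - s)%:E * path_length g 0 1)%E].

Definition geodesic_choice (X : set V) (geo : V -> V -> R -> V) : Prop :=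
  forall x y, X x -> X y -> is_geodesic X x y (geo x y).

Definition is_modulus (X : set V) (f : V -> R) (omega : R -> R) : Prop :=
  [/\ forall s, 0 <= s -> 0 <= omega s,
      forall s t, 0 <= s -> s <= t -> omega s <= omega t,
      omega 0 = 0 &
      forall x y, X x -> X y ->
        `|f x - f y| <= omega (fine (intrinsic_dist X x y))].

Definition concave_modulus (omega : R -> R) : Prop :=
  forall s t l, 0 <= s -> 0 <= t -> 0 <= l <= 1 ->
    (1 - l) * omega s + l * omega t <= omega ((1 - l) * s + l * t).

Definition intrinsic_lipschitz1 (X : set V) (f : V -> R) : Prop :=
  forall x y, X x -> X y -> (`|f x - f y|%:E <= intrinsic_dist X x y)%E.

Definition affine_defect (f : V -> R) (g : R -> V) (x y : V) : \bar R :=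
  ereal_sup [set `|f (g t) - ((1 - t) * f x + t * f y)|%:E | t in `[0, 1]].

Definition theta (X : set V) (f : V -> R) (geo : V -> V -> R -> V) (delta : R)
    : \bar R :=
  ereal_sup [set Order.max (2^-1 * `|f p.1 - f p.2|)%:E
                           (affine_defect f (geo p.1 p.2) p.1 p.2)
            | p in [set p : V * V | [/\ X p.1, X p.2 &
                      (intrinsic_dist X p.1 p.2 <= (2 * delta)%:E)%E]]].

Definition mu_scale (X : set V) (f : V -> R) (omega : R -> R)
    (geo : V -> V -> R -> V) (delta : R) : \bar R :=
  Order.max (omega delta)%:E (theta X f geo delta).

Definition edge (X : set V) (delta : R) (x y : V) : Prop :=
  x <> y /\ (intrinsic_dist X x y <= (2 * delta)%:E)%E.

(* The point of the edge from [x] to [y] at parameter [t], given by its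
   barycentric coordinates with respect to the vertices. *)
Definition edge_point (x y : V) (t : R) : {ptws V -> R} :=
  fun z => (1 - t) * (z == x)%:R + t * (z == y)%:R.

(* Geometric realization, in barycentric coordinates, of the graph with (finite)
   vertex set [S]; [x = y] gives the vertices. *)
Definition realization (X : set V) (delta : R) (S : set V) : set {ptws V -> R} :=
  [set c | exists x y t, [/\ S x, S y, x = y \/ edge X delta x y,
                             t \in `[0, 1] & c = edge_point x y t]].

Definition pl_extension (X : set V) (delta : R) (S : set V) (f : V -> R)
    (c : realization X delta S) : R :=
  \sum_(z \in S) (\val c : V -> R) z * f z.

Definition pl_reeb (X : set V) (delta : R) (S : set V) (f : V -> R)
    : precosheaf R := pi0_cosheaf (@pl_extension X delta S f).

Definition msupport (P : set V -> \bar R) : set V :=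
  [set x | forall U : set V, open U -> U x -> (0 < P U)%E].

Definition standard (X : set V) (P : set V -> \bar R) (a b : R) : Prop :=
  forall x r, X x -> 0 < r ->
    ((Num.min (a * r `^ b) 1)%:E <= P (intrinsic_ball X x r))%E.

Definition alpha (a b delta : R) (n : nat) : R :=
  Num.min 1 (4 `^ b / (a * delta `^ b) * expR (- (a * (delta / 2) `^ b * n%:R))).

End intrinsic.

Notation borel R m := (g_sigma_algebraType (@open 'rV[R]_m)).

Definition restr (T U : Type) (X : set T) (f : T -> U) : X -> U :=
  fun x => f (\val x).

Arguments restr {T U} X f _.

Definition iid_sample (R : realType) (d d' : measure_display)
    (Omega : measurableType d) (T : measurableType d')
    (Pr : probability Omega R) (P : probability T R) (n : nat)
    (Xs : 'I_n -> Omega -> T) : Prop :=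
  [/\ forall i, measurable_fun [set: Omega] (Xs i),
      forall i B, measurable B -> Pr (Xs i @^-1` B) = P B &
      forall B : 'I_n -> set T, (forall i, measurable (B i)) ->
        Pr (\bigcap_i (Xs i @^-1` B i)) =
        (\prod_(i < n) Pr (Xs i @^-1` B i))%E].

(* Inner probability: it gives a meaning to lower bounds on the probability of
   an event without first proving that the event is measurable, and it is the
   probability itself when the event is. *)
Definition inner_prob (R : realType) (d : measure_display)
    (Omega : measurableType d) (Pr : probability Omega R) (A : set Omega)
    : \bar R :=
  ereal_sup [set Pr B | B in [set B | measurable B /\ B `<=` A]].

Lemma inner_probE (R : realType) (d : measure_display)
    (Omega : measurableType d) (Pr : probability Omega R) (A : set Omega) :
  measurable A -> inner_prob Pr A = Pr A.
Proof.
move=> mA; apply/eqP; rewrite eq_le; apply/andP; split.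
  apply: ge_ereal_sup => _ [B [mB BA] <-].
  by apply: le_measure => //; rewrite inE.
by apply: ereal_sup_ubound; exists A => //; split.
Qed.

(* Main.v *)
(* Let S be the sample. A maximal delta/2-separated subset of X has few points,
   because the balls of radius delta/4 around them are disjoint and each has
   mass at least a (delta/4)^b; with high probability S meets all the balls of
   radius delta/2 around these points, hence is delta-dense in X.

   When S is delta-dense, sending a point of X to a sample point at distance at
   most delta, and an edge of the graph to the geodesic joining its endpoints,
   induces an interleaving with shift mu_delta. The first map is well defined on
   path components although it is not continuous: along a path in X, the sets of
   times spent in the closed delta-balls around the sample points of a given
   component of the graph are closed, and two such sets attached to distinct
   components are disjoint because sample points near a common point are
   adjacent; as finitely many of them cover the connected interval of times,
   only one is nonempty. Passing from X to its Reeb graph only uses that X is locally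
   path connected, which makes the path components of the preimage of an open
   interval open, and saturated. *)

Require Import Defs.
From HB Require Import structures.
From mathcomp Require Import all_boot all_order all_algebra generic_quotient.
From mathcomp Require Import interval_inference.
From mathcomp Require Import all_classical all_reals all_analysis.
From mathcomp Require Import ring lra unstable.
From Stdlib Require Import Relation_Operators.

Set Implicit Arguments.
Unset Strict Implicit.
Unset Printing Implicit Defensive.

Import Order.TTheory GRing.Theory Num.Theory numFieldNormedType.Exports.

Local Open Scope classical_set_scope.
Local Open Scope ring_scope.
Local Open Scope quotient_scope.

(** * Paths, Reeb graphs and constructible spaces *)

Lemma continuous_compose (T U V : topologicalType) (g : T -> U) (h : U -> V) :
  continuous g -> continuous h -> continuous (h \o g).
Proof.
by move=> cg ch t; apply: continuous_comp; [exact: cg|exact: ch].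
Qed.

Definition set_elt (T : Type) (A : set T) (x : T) (Ax : A x) : A :=
  exist _ x (mem_set Ax).

Section topology_complements.
Context {S T : topologicalType}.

(** Pasting lemma: the preimage of a closed set is a finite union of closed pieces. It glues paths
    at a midpoint and the geodesic map along the edges of the graph. *)
Lemma continuous_finite_closed_cover (I : choiceType) (D : set I)
    (C : I -> set S) (h : I -> S -> T) (f : S -> T) :
  finite_set D -> (forall i, D i -> closed (C i)) ->
  (forall i, D i -> continuous (h i)) ->
  (forall s, exists2 i, D i & C i s) ->
  (forall i s, D i -> C i s -> f s = h i s) ->
  continuous f.
Proof.
move=> finD cC ch cov fh; apply/continuous_closedP => A cA.
rewrite (_ : _ @^-1` _ = \bigcup_(i in D) (C i `&` h i @^-1` A)).
  apply: closed_bigcup => // i Di; apply: closedI; first exact: cC.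
  by move/continuous_closedP : (ch i Di); apply.
apply/seteqP; split => [s Afs|s [i Di [Cis]]]; last first.
  by rewrite /preimage/= (fh i).
by have [i Di Cis] := cov s; exists i => //; split => //=; rewrite -(fh i).
Qed.

Lemma continuous_subtype (A : set T) (f : S -> A) :
  continuous (\val \o f) -> continuous f.
Proof.
move=> /continuousP cf; apply/continuousP => U [W oW <-].
by rewrite -comp_preimage; exact: cf.
Qed.

Lemma continuous_val (A : set T) : continuous (\val : A -> T).
Proof. exact: initial_continuous. Qed.

End topology_complements.

(** Paths are extended to the whole line below, so connectedness of [R] itself replaces that of the
    unit interval. *)
Lemma connected_line (R : realType) (A : set R) :
  open A -> open (~` A) -> A !=set0 -> A = setT.
Proof.
move=> oA oA' A0.
have /connected_intervalP : is_interval [set: R] by [].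
move=> /(_ A A0); apply; first by exists A; rewrite ?setTI.
by exists A; rewrite ?setTI// -openC.
Qed.

Section clamp.
Context {R : realType}.

(** The retraction of the line onto the unit interval, which extends a path constantly beyond its
    endpoints. *)
Definition clamp (t : R) : R := Num.max 0 (Num.min 1 t).

Lemma clamp_continuous : continuous clamp.
Proof.
move=> t; apply: (@continuous_max R R (cst 0) (cst 1 \min id) t).
  exact: cst_continuous.
by apply: (@continuous_min R R (cst 1) id t) => //; exact: cst_continuous.
Qed.

Lemma clamp_itv t : clamp t \in `[0, 1].
Proof.
rewrite /clamp in_itv/= le_max lexx/= ge_max ler01/=.
by rewrite ge_min lexx.
Qed.

Lemma clamp_id t : 0 <= t <= 1 -> clamp t = t.
Proof.
by move=> /andP[t0 t1]; rewrite /clamp (min_idPr t1) (max_idPr t0).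
Qed.

Lemma continuous_clamp (T : topologicalType) (g : R -> T) :
  {within `[0, 1], continuous g} -> continuous (g \o clamp).
Proof.
move=> /subspace_continuousP cg t.
apply: (@cvg_comp _ _ _ clamp g _ (within `[0, 1] (nbhs (clamp t)))).
  move=> A nA; have := @clamp_continuous t _ nA.
  change (nbhs t (clamp @^-1` (fun s => s \in `[0, 1] -> A s)) ->
    nbhs t (clamp @^-1` A)).
  apply: filterS => s; apply; exact: clamp_itv.
by apply: cg; exact: (clamp_itv t).
Qed.

End clamp.

Lemma affine_continuous (R : realType) (u v : R) : continuous (fun t : R => u * t + v).
Proof.
move=> t; apply: continuousD; last exact: cst_continuous.
by apply: continuousM => //; exact: cst_continuous.
Qed.

Section joined.
Context {R : realType} {T : topologicalType}.
Implicit Types (A B : set T) (x y z : T).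

(** Precomposing with [clamp] turns a path continuous within the unit interval into one continuous
    on the line and staying in [A] at all times. *)
Lemma joinedP A x y : joined R A x y <->
  exists g : R -> T, [/\ continuous g, g 0 = x, g 1 = y & forall t, A (g t)].
Proof.
split=> [[g [cg g0 g1 gA]]|[g [cg g0 g1 gA]]].
  exists (g \o clamp); split.
  - exact: continuous_clamp.
  - by rewrite /= clamp_id// lexx ler01.
  - by rewrite /= clamp_id// lexx ler01.
  - by move=> t; apply: gA; exact: clamp_itv.
by exists g; split => //; exact: continuous_subspaceT.
Qed.

End joined.

Section joined_operations.
Context {R : realType} {T : topologicalType}.
Implicit Types (A B : set T) (x y z : T).

Lemma joined_image (T' : topologicalType) A (B : set T') (h : T -> T') x y :
  continuous h -> (forall z, A z -> B (h z)) ->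
  joined R A x y -> joined R B (h x) (h y).
Proof.
move=> ch AB /joinedP[g [cg g0 g1 gA]]; apply/joinedP; exists (h \o g).
split; rewrite /= ?g0 ?g1//; last by move=> t; exact: AB.
exact: continuous_compose.
Qed.

Lemma joinedS A B x y : A `<=` B -> joined R A x y -> joined R B x y.
Proof. by move=> AB; apply: (@joined_image _ A B id x y _ AB) => z U. Qed.

Lemma joined_refl A x : A x -> joined R A x x.
Proof.
by move=> Ax; apply/joinedP; exists (cst x); split => // t; exact: cst_continuous.
Qed.

Lemma joined_sym A x y : joined R A x y -> joined R A y x.
Proof.
move=> /joinedP[g [cg g0 g1 gA]]; apply/joinedP.
exists (g \o (fun t => -1 * t + 1)); split => //=.
- by apply: continuous_compose cg; exact: affine_continuous.
- by rewrite mulr0 add0r.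
- by rewrite mulr1 addNr.
Qed.

Definition concat (g h : R -> T) (t : R) : T :=
  if t <= 2^-1 then g (2 * t) else h (2 * t - 1).

Lemma concat_continuous (g h : R -> T) :
  continuous g -> continuous h -> g 1 = h 0 -> continuous (concat g h).
Proof.
move=> cg ch gh.
apply: (@continuous_finite_closed_cover R T bool setT
  (fun i => if i then [set t | t <= 2^-1] else [set t | 2^-1 <= t])
  (fun i => if i then g \o (fun t => 2 * t + 0) else h \o (fun t => 2 * t - 1))).
- exact: finite_finset.
- by case=> _; [exact: closed_le|exact: closed_ge].
- by case=> _; apply: continuous_compose => //; exact: affine_continuous.
- move=> t; have [t2|/ltW t2] := leP t 2^-1; first by exists true.
  by exists false.
- move=> [] t _ /=; rewrite /concat.
    by move=> ->; rewrite addr0.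
  have [t2 t2'|//] := leP t 2^-1.
  have -> : t = 2^-1 by apply/eqP; rewrite eq_le t2.
  by rewrite divff// subrr gh.
Qed.

Lemma concat0 (g h : R -> T) : concat g h 0 = g 0.
Proof. by rewrite /concat mulr0 invr_ge0 ler0n. Qed.

Lemma concat1 (g h : R -> T) : concat g h 1 = h 1.
Proof.
rewrite /concat; case: ifPn => [|_]; last by congr h; lra.
by move=> ?; exfalso; lra.
Qed.

Lemma joined_trans A x y z :
  joined R A x y -> joined R A y z -> joined R A x z.
Proof.
move=> /joinedP[g [cg g0 g1 gA]] /joinedP[h [ch h0 h1 hA]]; apply/joinedP.
exists (concat g h); split.
- by apply: concat_continuous => //; rewrite g1 h0.
- by rewrite concat0.
- by rewrite concat1.
- by move=> t; rewrite /concat; case: ifP.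
Qed.

Lemma joinedl A x y : joined R A x y -> A x.
Proof. by move=> /joinedP[g [_ <- _ gA]]. Qed.

Lemma joinedr A x y : joined R A x y -> A y.
Proof. by move=> /joinedP[g [_ _ <- gA]]. Qed.

Lemma joined_along A (g : R -> T) s t : continuous g ->
  (forall u, Num.min s t <= u <= Num.max s t -> A (g u)) ->
  joined R A (g s) (g t).
Proof.
move=> cg gA; apply/joinedP.
exists (fun u => g ((t - s) * clamp u + s)); split.
- apply: (continuous_compose (g := fun u => (t - s) * clamp u + s) _ cg).
  apply: (continuous_compose (h := fun v => (t - s) * v + s)).
    exact: clamp_continuous.
  exact: affine_continuous.
- by rewrite clamp_id ?lexx ?ler01// mulr0 add0r.
- by rewrite clamp_id ?lexx ?ler01// mulr1 subrK.
- move=> u; apply: gA; have := clamp_itv u; rewrite in_itv/= => /andP[u0 u1].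
  rewrite ge_min le_max.
  have [st|/ltW ts] := leP s t; apply/andP; split; apply/orP.
  + by left; nra.
  + by right; nra.
  + by right; nra.
  + by left; nra.
Qed.

(** [joined] is already an equivalence relation on [A], so the generated relation adds nothing to
    it. *)
Lemma pi0_eqP A (x y : A) :
  \pi_(pi0 R A) x = \pi_(pi0 R A) y <-> joined R A (\val x) (\val y).
Proof.
split=> [/glueP h|h]; last by apply/glueP; exact: rst_step.
elim: h => {x y} [//|x|x y _|x y z _ xy _]; last exact: joined_trans.
- by apply: joined_refl; exact: set_valP.
- exact: joined_sym.
Qed.

End joined_operations.

Section reeb.
Context {R : realType} {T : topologicalType} (f : T -> R).

Lemma reeb_eqP (x y : T) :
  \pi_(reeb_graph f) x = \pi_(reeb_graph f) y <-> reeb_rel f x y.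
Proof.
split=> [/glueP h|h]; last by apply/glueP; exact: rst_step.
elim: h => {x y} [//|x|x y _ [fxy xy]|x y z _ [fxy xy] _ [fyz yz]].
- by split => //; exact: joined_refl.
- by split; [|rewrite -fxy; exact: joined_sym].
- split; first by rewrite fxy.
  by apply: joined_trans xy _; rewrite fxy.
Qed.

Lemma pi_reeb_continuous : continuous (\pi_(reeb_graph f) : T -> reeb_graph f).
Proof. exact: pi_continuous. Qed.

End reeb.

(** * Local path connectedness of constructible spaces *)

Section locally_joined.
Context (R : realType).

(* Weaker than local path connectedness for a single pair [x], [U], but
   equivalent to it when required of all open sets [U], and easier to transport
   to quotients. *)
Definition locally_joined (T : topologicalType) : Prop :=
  forall (x : T) (U : set T), open U -> U x ->
    exists V, [/\ open V, V x & forall y, V y -> joined R U x y].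

Lemma lpc_locally_joined (T : topologicalType) :
  locally_path_connected R T -> locally_joined T.
Proof.
move=> lpcT x U oU Ux; have [V [oV Vx VU [_ cV]]] := lpcT x U oU Ux.
by exists V; split => // y Vy; apply: joinedS VU _; exact: cV.
Qed.

Lemma open_joined (T : topologicalType) (U : set T) (x : T) :
  locally_joined T -> open U -> open [set y | joined R U x y].
Proof.
move=> ljT oU; rewrite openE => y /= xy.
have [V [oV Vy VU]] := ljT y U oU (joinedr xy).
rewrite /interior nbhsE; exists V => // z /VU; exact: joined_trans.
Qed.

Lemma locally_joined_homeo (T T' : topologicalType) (h : T -> T') (h' : T' -> T) :
  continuous h -> continuous h' -> cancel h h' -> cancel h' h ->
  locally_joined T -> locally_joined T'.
Proof.
move=> ch ch' hK h'K ljT x U oU Ux.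
have [||V [oV Vx VU]] := ljT (h' x) (h @^-1` U).
- by move/continuousP : ch; apply.
- by rewrite /preimage/= h'K.
exists (h' @^-1` V); split => //; first by move/continuousP : ch'; apply.
move=> y /VU xy; rewrite -(h'K x) -(h'K y).
by apply: joined_image ch _ xy.
Qed.

(** The path component of [x] in [U] serves as the neighbourhood. It is open in the quotient because
    its preimage is open: short paths upstairs project to paths in [U]. *)
Lemma locally_joined_glue (T : topologicalType) (r : T -> T -> Prop) :
  locally_joined T -> locally_joined (Defs.glue r).
Proof.
move=> ljT x U oU Ux; exists [set y | joined R U x y]; split => //; last first.
  exact: joined_refl.
have cpi : continuous (fun y : T => \pi_(Defs.glue r) y).
  exact: pi_continuous.
change (open ((fun y : T => \pi_(Defs.glue r) y) @^-1` [set y | joined R U x y])).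
rewrite openE => z /= xz.
have [|V [oV Vz VU]] := ljT z ((fun y : T => \pi_(Defs.glue r) y) @^-1` U) oU.
  exact: (joinedr xz).
rewrite /interior nbhsE; exists V => // y /VU zy.
by apply: joined_trans xz _; apply: joined_image cpi _ zy.
Qed.

Lemma locally_joined_sigT (I : choiceType) (X : I -> topologicalType) :
  (forall i, locally_joined (X i)) -> locally_joined {i & X i}.
Proof.
move=> ljX [i x] U /sigT_openP oU Ux.
have [V [oV Vx VU]] := ljX i x _ (oU i) Ux.
exists (existT X i @` V); split => //; first exact: existT_open_map.
move=> _ [y /VU xy <-]; apply: joined_image xy => //; exact: existT_continuous.
Qed.

Lemma locally_joined_prod (T T' : topologicalType) :
  locally_joined T -> locally_joined T' -> locally_joined (T * T')%type.
Proof.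
move=> ljT ljT' [x x'] U oU Ux.
have [[A B] /= [nA nB] ABU] : nbhs (x, x') U by exact: open_nbhs_nbhs.
move: nA nB; rewrite !nbhsE => -[A' [oA' A'x] A'A] [B' [oB' B'x] B'B].
have [V [oV Vx VA]] := ljT x A' oA' A'x.
have [W [oW Wx WB]] := ljT' x' B' oB' B'x.
exists (V `*` W); split => //.
  rewrite openE => -[y y'] [/= Vy Wy']; exists (V, W) => //=.
  by split; exact: open_nbhs_nbhs.
move=> [y y'] [/= /VA/joinedP[g [cg g0 g1 gA]] /WB/joinedP[h [ch h0 h1 hB]]].
apply/joinedP; exists (fun t => (g t, h t)); split; rewrite ?g0 ?g1 ?h0 ?h1//.
  by move=> t; apply: cvg_pair; [exact: cg|exact: ch].
by move=> t; apply: ABU; split; [exact/A'A/gA|exact/B'B/hB].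
Qed.

(** Straight segments stay both in the interval and in a ball. This handles the height factors of
    the vertex and strip pieces. *)
Lemma locally_joined_interval (A : set R) : is_interval A -> locally_joined A.
Proof.
move=> iA x _ [W oW <-] Wx.
have : nbhs (\val x : R) W by exact: open_nbhs_nbhs.
move=> /nbhs_ballP[e /= e0 eW].
exists (\val @^-1` ball (\val x) e); split.
- by exists (ball (\val x) e) => //; exact: ball_open.
- exact: ballxx.
move=> y xye.
have bA t : A ((\val y - \val x) * clamp t + \val x).
  have Ax : A (\val x) by exact: set_valP.
  have Ay : A (\val y) by exact: set_valP.
  have /andP[t0 t1] : 0 <= clamp t <= 1 by have := clamp_itv t; rewrite in_itv.
  have [xy|/ltW yx] := leP (\val x) (\val y).
    by apply: (iA (\val x) (\val y)) => //; apply/andP; split; nra.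
  by apply: (iA (\val y) (\val x)) => //; apply/andP; split; nra.
apply/joinedP; exists (fun t => set_elt (bA t)); split.
- apply: continuous_subtype.
  apply: (continuous_compose (h := fun v => (\val y - \val x) * v + \val x)).
    exact: clamp_continuous.
  exact: affine_continuous.
- by apply: val_inj; rewrite /= clamp_id ?lexx ?ler01// mulr0 add0r.
- by apply: val_inj; rewrite /= clamp_id ?lexx ?ler01// mulr1 subrK.
- move=> t; apply: eW => /=; move: xye; rewrite /preimage/= /ball/= => xye.
  have := clamp_itv t; rewrite in_itv/= => /andP[t0 t1].
  rewrite opprD addrCA subrr addr0 normrN normrM (ger0_norm t0).
  rewrite distrC; apply: le_lt_trans xye.
  by rewrite distrC ler_piMr.
Qed.

Lemma locally_joined_cd_space (D : constructible_data R) :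
  locally_joined (cd_space D).
Proof.
apply: locally_joined_glue; apply: locally_joined_sigT => -[i|i] /=.
  apply: locally_joined_prod; first exact/lpc_locally_joined/cd_V_lpc.
  apply: locally_joined_interval => x y /= -> -> z /andP[xz zx].
  by apply/eqP; rewrite eq_le xz zx.
apply: locally_joined_prod; first exact/lpc_locally_joined/cd_E_lpc.
by apply: locally_joined_interval; exact: interval_is_interval.
Qed.

Lemma locally_joined_constructible (T : topologicalType) (f : T -> R) :
  constructible f -> locally_joined T.
Proof.
move=> [_ [D [h [h' [ch ch' hK h'K _]]]]].
have := @locally_joined_homeo _ _ h h' ch ch' hK h'K.
apply; exact: locally_joined_cd_space.
Qed.

End locally_joined.

(* The path components of an open [f @^-1` W] are open and saturated, so their
   images are disjoint open sets of the Reeb graph, and a path there stays in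
   the image of one of them. *)
Lemma joined_reeb (R : realType) (T : topologicalType) (f : T -> R) (W : set R)
    (x y : reeb_graph f) :
  locally_joined R T -> continuous f -> open W ->
  joined R (@reeb_fun R T f @^-1` W) x y ->
  joined R (f @^-1` W) (repr x) (repr y).
Proof.
move=> ljT cf oW /joinedP[c [cc c0 c1 cW]].
have oU : open (f @^-1` W) by move/continuousP : cf; apply.
have Wx : W (f (repr x)) by rewrite -c0; exact: cW.
pose K (z : reeb_graph f) := joined R (f @^-1` W) (repr x) (repr z).
(* A point and the representative of its Reeb class are joined within their common level set, hence
   over [W]. *)
have reprj z : W (f z) ->
    joined R (f @^-1` W) z (repr (\pi_(reeb_graph f) z)).
  move=> Wz; have /reeb_eqP[_] :
      \pi_(reeb_graph f) z = \pi_(reeb_graph f) (repr (\pi_(reeb_graph f) z)).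
    by rewrite reprK.
  by apply: joinedS => w; rewrite /preimage/= => ->.
have oK : open [set z | K z].
  rewrite /open/= /quotient_open.
  rewrite (_ : _ @^-1` _ = [set z | joined R (f @^-1` W) (repr x) z]).
    exact: open_joined.
  apply/seteqP; split => z /=; rewrite /K => xz.
    apply: joined_trans (xz) _; apply/joined_sym/reprj.
    by rewrite -[f z](reeb_fun_pi f); exact: joinedr xz.
  by apply: joined_trans (xz) _; apply: reprj; exact: joinedr xz.
(* The rest of the preimage of [W] is a union of other components, so it is open too; its pullback
   by [c] is the full complement because [c] stays over [W]. *)
have oK' : open [set z | W (reeb_fun z) /\ ~ K z].
  rewrite /open/= /quotient_open openE => z /= [Wz Kz].
  rewrite reeb_fun_pi in Wz; rewrite /interior nbhsE.
  exists [set w | joined R (f @^-1` W) z w].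
    by split; [exact: open_joined|exact: joined_refl].
  move=> w /= zw; split; first by rewrite reeb_fun_pi; exact: joinedr zw.
  move=> Kw; apply: Kz; rewrite /K; apply: joined_trans Kw _.
  apply: joined_trans (joined_sym (reprj w (joinedr zw))) _.
  by apply: joined_trans (joined_sym zw) _; exact: reprj.
have : [set t | K (c t)] = setT.
  apply: connected_line.
  - by move/continuousP : cc => /(_ _ oK).
  - move/continuousP : cc => /(_ _ oK').
    rewrite (_ : _ @^-1` _ = ~` [set t | K (c t)])//.
    by apply/seteqP; split => t /= => [[]//|Kt]; split => //; exact: cW.
  - by exists 0; rewrite /= c0 /K; exact: joined_refl.
by move=> /seteqP[_ /(_ 1 I)]; rewrite /= c1.
Qed.

(** * The intrinsic metric *)

Section euclidean_norm.
Context {R : realType} {m : nat}.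
Implicit Types u v : 'rV[R]_m.

Lemma enorm_ge0 v : 0 <= enorm v. Proof. exact: sqrtr_ge0. Qed.

Lemma sqr_enorm v : enorm v ^+ 2 = \sum_(i < m) v ord0 i ^+ 2.
Proof. by rewrite sqr_sqrtr// sumr_ge0// => i _; exact: sqr_ge0. Qed.

Lemma enorm0 : enorm (0 : 'rV[R]_m) = 0.
Proof.
by rewrite /enorm big1 ?sqrtr0// => i _; rewrite mxE expr0n.
Qed.

Lemma enormN v : enorm (- v) = enorm v.
Proof. by rewrite /enorm; under eq_bigr do rewrite mxE sqrrN. Qed.

Lemma enorm_distC u v : enorm (u - v) = enorm (v - u).
Proof. by rewrite -enormN opprB. Qed.

(** Compares the sup norm, which defines the topology of row vectors, with the Euclidean norm, which
    defines lengths. *)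
Lemma normr_le_enorm v : `|v| <= enorm v.
Proof.
rewrite -[`|v|]/(mx_norm v) mx_normE.
have : 0 <= enorm v by exact: enorm_ge0.
move=> e0; rewrite -[leRHS]/((NngNum e0)%:num) num_le.
apply/bigmax_leP; split; first by rewrite -num_le.
move=> [i j] _; rewrite -num_le/= -sqrtr_sqr ler_wsqrtr// (ord1 i).
by rewrite (bigD1 j)//= lerDl sumr_ge0// => k _; exact: sqr_ge0.
Qed.

Lemma enorm_eq0 v : enorm v = 0 -> v = 0.
Proof.
by move=> v0; apply/eqP; rewrite -normr_le0 -v0; exact: normr_le_enorm.
Qed.

Lemma cauchy_schwarz u v :
  \sum_(i < m) u ord0 i * v ord0 i <= enorm u * enorm v.
Proof.
have [u0|u0] := eqVneq (enorm u) 0.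
  rewrite u0 (enorm_eq0 u0) mul0r big1// => i _.
  by rewrite mxE mul0r.
have [v0|v0] := eqVneq (enorm v) 0.
  rewrite v0 (enorm_eq0 v0) mulr0 big1// => i _.
  by rewrite mxE mulr0.
have p0 : 0 < enorm u * enorm v by rewrite mulr_gt0// lt_def ?u0 ?v0 enorm_ge0.
(* Expanding the squared norm of [enorm v * u - enorm u * v] yields the inequality after division by
   twice the product of the norms. *)
have : 0 <= \sum_(i < m) (enorm v * u ord0 i - enorm u * v ord0 i) ^+ 2.
  by apply: sumr_ge0 => i _; exact: sqr_ge0.
have -> : \sum_(i < m) (enorm v * u ord0 i - enorm u * v ord0 i) ^+ 2 =
    2 * (enorm u * enorm v) *
    (enorm u * enorm v - \sum_(i < m) u ord0 i * v ord0 i).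
  transitivity (enorm v ^+ 2 * enorm u ^+ 2 + enorm u ^+ 2 * enorm v ^+ 2 -
      2 * (enorm u * enorm v) * \sum_(i < m) u ord0 i * v ord0 i); last by ring.
  rewrite [X in _ = _ * X + _ - _]sqr_enorm [X in _ = _ + _ * X - _]sqr_enorm !mulr_sumr -big_split/= -sumrB.
  by apply: eq_bigr => i _; ring.
by rewrite pmulr_rge0 ?subr_ge0// mulr_gt0.
Qed.

Lemma enormD u v : enorm (u + v) <= enorm u + enorm v.
Proof.
rewrite -(ler_pXn2r (n := 2))// ?nnegrE ?addr_ge0 ?enorm_ge0//.
have -> : enorm (u + v) ^+ 2 =
    enorm u ^+ 2 + enorm v ^+ 2 + 2 * \sum_(i < m) u ord0 i * v ord0 i.
  rewrite !sqr_enorm mulr_sumr -!big_split/=.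
  by apply: eq_bigr => i _; rewrite mxE; ring.
by have := cauchy_schwarz u v; nra.
Qed.

Lemma enorm_triangle u v w : enorm (u - w) <= enorm (u - v) + enorm (v - w).
Proof. by rewrite (le_trans _ (enormD _ _))// subrKA. Qed.

End euclidean_norm.

Section partitions.
Context {R : realType}.
Implicit Types (a b c : R) (s : seq R).

Lemma itv_partition_itv a b s x :
  itv_partition a b s -> x \in a :: s -> a <= x <= b.
Proof.
elim: s a => [a|y s ih a] ps.
  by rewrite inE => /eqP ->; rewrite lexx (itv_partition_le ps).
have ab := itv_partition_le ps.
rewrite inE => /predU1P[->|xs]; first by rewrite lexx.
have [/= /andP[ay _] _] := ps.
have /andP[yx ->] := ih y (itv_partition_cons ps) xs.
by rewrite (ltW (lt_le_trans ay yx)).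
Qed.

Lemma itv_partition_map (phi : R -> R) a b s :
  {homo phi : x y / x < y} -> itv_partition a b s ->
  itv_partition (phi a) (phi b) (map phi s).
Proof.
move=> ph [ps /eqP ls]; split; last by rewrite last_map ls.
by rewrite (homo_path (e := <%O)).
Qed.

(** A partition list omits its left end and contains its right end. Hence the reversed list must
    gain [phi a] and lose [phi b], which is the effect of [belast]. *)
Lemma itv_partition_map_rev (phi : R -> R) a b s :
  {homo phi : x y /~ x < y} -> itv_partition a b s ->
  itv_partition (phi b) (phi a) (rev (belast (phi a) (map phi s))).
Proof.
move=> ph [ps /eqP ls]; split.
  have -> : phi b = last (phi a) (map phi s) by rewrite last_map ls.
  rewrite rev_path path_map; apply: sub_path ps => x y; exact: ph.
case: s ps ls => [_ <-//|y s _ <-].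
by rewrite /= rev_cons last_rcons.
Qed.

End partitions.

(** * Polygonal sums and lengths of paths *)

Section polygonal_sums.
Context {R : realType} {m : nat}.
Implicit Types (g h : R -> 'rV[R]_m) (a b c : R) (s : seq R).

(** Recursive form of [polygonal_sum], suited to induction on the list of subdivision points. *)
Fixpoint psum g a s : R :=
  if s is b :: s' then enorm (g b - g a) + psum g b s' else 0.

Lemma polygonal_sumE g a b s : polygonal_sum g a b s = psum g a s.
Proof.
rewrite /polygonal_sum; elim: s a => [|c s ih] a; first by rewrite big_geq.
by rewrite big_nat_recl//= -ih.
Qed.

Lemma psum_ge0 g a s : 0 <= psum g a s.
Proof. by elim: s a => //= c s ih a; rewrite addr_ge0// enorm_ge0. Qed.

Lemma psum_comp g (phi : R -> R) a s :
  psum (g \o phi) a s = psum g (phi a) (map phi s).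
Proof. by elim: s a => //= c s ih a; rewrite ih. Qed.

Lemma psum_cst x a s : psum (cst x) a s = 0.
Proof. by elim: s a => //= c s ih a; rewrite subrr enorm0 ih addr0. Qed.

Lemma eq_psum g h a s : {in a :: s, g =1 h} -> psum g a s = psum h a s.
Proof.
elim: s a => //= c s ih a gh; rewrite ih => [|x xs].
  by rewrite !gh// !inE eqxx ?orbT.
by apply: gh; rewrite inE xs orbT.
Qed.

Lemma psum_rcons g a s b :
  psum g a (rcons s b) = psum g a s + enorm (g b - g (last a s)).
Proof.
by elim: s a => /= [a|c s ih a]; rewrite ?addr0 ?add0r// ih addrA.
Qed.

Lemma psum_rev g a s : psum g (last a s) (rev (belast a s)) = psum g a s.
Proof.
elim: s a => //= c s ih a; rewrite rev_cons psum_rcons ih addrC enorm_distC.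
congr (enorm (g _ - _) + _).
by case: s {ih} => //= d s; rewrite rev_cons last_rcons.
Qed.

(** Inserting [c] affects only the segment that contains it, where the triangle inequality
    applies. *)
Lemma psum_split g a b c s : a <= c -> c <= b -> itv_partition a b s ->
  psum g a s <=
    psum g a (itv_partitionL s c) + psum g c (itv_partitionR s c).
Proof.
elim: s a => [|y s ih] a ac cb ps.
  by rewrite addr_ge0// psum_ge0.
have [/= /andP[ay pys] _] := ps; rewrite /itv_partitionL /itv_partitionR /=.
have ss : path <%O y s by [].
case: ltgtP => [yc|cy|yc] /=.
- by rewrite -addrA lerD2l; apply: ih => //; [exact: ltW|exact: itv_partition_cons ps].
- have cs := path_lt_head cy pys.
  rewrite path_lt_filter0// path_lt_filterT//=.
  by rewrite addr0 addrA lerD2r addrC enorm_triangle.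
- by rewrite -yc path_lt_filter0 ?path_lt_filterT//= addr0.
Qed.

End polygonal_sums.

Section path_length.
Context {R : realType} {m : nat}.
Implicit Types (g h : R -> 'rV[R]_m) (a b c : R) (s : seq R).

Lemma psum_le_length g a b s :
  itv_partition a b s -> ((psum g a s)%:E <= path_length g a b)%E.
Proof.
by move=> ps; apply: ereal_sup_ubound; exists s; rewrite ?polygonal_sumE.
Qed.

Lemma length_le g a b (l : \bar R) :
  (forall s, itv_partition a b s -> ((psum g a s)%:E <= l)%E) ->
  (path_length g a b <= l)%E.
Proof.
by move=> gl; apply: ge_ereal_sup => _ [s ps <-]; rewrite polygonal_sumE; exact: gl.
Qed.

Lemma path_length_map g h (phi : R -> R) a b :
  {homo phi : x y / x < y} -> (forall t, a <= t <= b -> h t = g (phi t)) ->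
  (path_length h a b <= path_length g (phi a) (phi b))%E.
Proof.
move=> ph hg; apply: length_le => s ps.
rewrite (@eq_psum _ _ _ (g \o phi)) => [|x xs]; last first.
  exact/hg/(itv_partition_itv ps).
by rewrite psum_comp; apply: psum_le_length; exact: itv_partition_map.
Qed.

Lemma path_length_rev g (phi : R -> R) a b :
  {homo phi : x y /~ x < y} ->
  (path_length (g \o phi) a b <= path_length g (phi b) (phi a))%E.
Proof.
move=> ph; apply: length_le => s ps; rewrite psum_comp -psum_rev.
have [_ /eqP ls] := ps; rewrite last_map ls.
by apply: psum_le_length; exact: itv_partition_map_rev.
Qed.

Lemma eq_path_length g h a b : (forall t, a <= t <= b -> h t = g t) ->
  path_length h a b = path_length g a b.
Proof.
move=> hg; apply/eqP; rewrite eq_le.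
rewrite (@path_length_map _ _ id)//= (@path_length_map _ _ id)// => t /hg.
exact: esym.
Qed.

Lemma path_lengthxx g a : path_length g a a = 0%E.
Proof.
apply/eqP; rewrite eq_le; apply/andP; split.
  by apply: length_le => s /itv_partitionxx ->.
exact: (@psum_le_length _ _ _ [::]).
Qed.

Lemma enorm_le_length g a b :
  a <= b -> ((enorm (g b - g a))%:E <= path_length g a b)%E.
Proof.
rewrite le_eqVlt => /predU1P[->|ab]; first by rewrite subrr enorm0 path_lengthxx.
by have := psum_le_length g (itv_partition1 ab); rewrite /= addr0.
Qed.

Lemma path_length_ge0 g a b : a <= b -> (0 <= path_length g a b)%E.
Proof.
by move=> ab; apply: le_trans (enorm_le_length g ab); rewrite lee_fin enorm_ge0.
Qed.

(** Every partition is refined at the midpoint, and each half is then rescaled to the unit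
    interval. *)
Lemma path_length_concat g h : g 1 = h 0 ->
  (path_length (concat g h) 0 1 <= path_length g 0 1 + path_length h 0 1)%E.
Proof.
move=> gh; apply: length_le => s ps.
have lt02 : 0 < 2^-1 :> R by lra.
have lt21 : 2^-1 < 1 :> R by lra.
have pL := itv_partitionLP lt02 lt21 ps.
have pR := itv_partitionRP lt02 lt21 ps.
apply: (@le_trans _ _ ((psum (concat g h) 0 (itv_partitionL s 2^-1))%:E +
   (psum (concat g h) 2^-1 (itv_partitionR s 2^-1))%:E)%E).
  by rewrite -EFinD lee_fin; apply: psum_split ps; exact: ltW.
rewrite (@eq_psum _ _ _ (g \o (fun t => 2 * t))) => [|x xs]; last first.
  by have /andP[_ x2] := itv_partition_itv pL xs; rewrite /concat x2.
rewrite (@eq_psum _ _ (concat g h) (h \o (fun t => 2 * t - 1))) => [|x xs]; last first.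
  have /andP[x2 _] := itv_partition_itv pR xs; rewrite /concat/=.
  case: ifPn => // x2'; have -> : x = 2^-1 by apply/eqP; rewrite eq_le x2'.
  by rewrite divff// subrr gh.
have e0 : 2 * 0 = 0 :> R by rewrite mulr0.
have e1 : 2 * 2^-1 = 1 :> R by rewrite divff.
have e2 : 2 * 1 - 1 = 1 :> R by lra.
have e3 : 2 * 2^-1 - 1 = 0 :> R by lra.
rewrite (psum_comp g) (psum_comp h) e0 e3; apply: leeD.
- apply: psum_le_length; rewrite -[X in itv_partition X]e0 -[X in itv_partition _ X]e1.
  by apply: itv_partition_map pL => x y xy; rewrite ltr_pM2l.
- apply: psum_le_length; rewrite -[X in itv_partition X]e3 -[X in itv_partition _ X]e2.
  by apply: itv_partition_map pR => x y xy; rewrite ltrD2r ltr_pM2l.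
Qed.

End path_length.

(** * Metric properties of the intrinsic distance and of geodesics *)

Section intrinsic_metric.
Context {R : realType} {m : nat} (X : set 'rV[R]_m).
Local Notation d := (intrinsic_dist X).
Implicit Types x y z : 'rV[R]_m.

Lemma intrinsic_dist_ge0 x y : (0 <= d x y)%E.
Proof. by apply: le_ereal_inf_tmp => _ [g _ <-]; exact: path_length_ge0. Qed.

Lemma enorm_le_dist x y : ((enorm (y - x))%:E <= d x y)%E.
Proof.
apply: le_ereal_inf_tmp => _ [g [_ <- <- _] <-]; exact: enorm_le_length.
Qed.

(** The infimum over no path is [+oo], so a finite bound provides a path in [X], which contains its
    own endpoints. *)
Lemma intrinsic_dist_le_fin x y (r : R) : (d x y <= r%:E)%E -> X x /\ X y.
Proof.
move=> xyr.
have : [set path_length g 0 1 | g in is_path X x y] !=set0.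
  apply/set0P/eqP => e; move: xyr; rewrite /intrinsic_dist e ereal_inf0.
  by rewrite leye_eq.
move=> [_ [g [_ <- <- gX] _]].
by split; apply: gX; rewrite in_itv/= ?lexx ?ler01.
Qed.

Lemma intrinsic_dist_le_length (g : R -> 'rV[R]_m) :
  continuous g -> (forall u, X (g u)) -> (d (g 0%R) (g 1%R) <= path_length g 0 1)%E.
Proof.
move=> cg gX; apply: ereal_inf_lbound; exists g => //; split => //.
exact: continuous_subspaceT.
Qed.

Lemma intrinsic_distxx x : X x -> d x x = 0%E.
Proof.
move=> Xx; apply/eqP; rewrite eq_le intrinsic_dist_ge0 andbT.
have := @intrinsic_dist_le_length (cst x) (fun t => @cst_continuous _ _ _ t) (fun=> Xx).
move=> /le_trans; apply; apply: length_le => s ps.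
by rewrite psum_cst.
Qed.

Lemma path_clamp x y g : is_path X x y g ->
  [/\ continuous (g \o clamp), forall t, X ((g \o clamp) t),
      (g \o clamp) 0 = x, (g \o clamp) 1 = y &
      forall s t, 0 <= s -> t <= 1 ->
        path_length (g \o clamp) s t = path_length g s t].
Proof.
move=> [cg g0 g1 gX]; split.
- exact: continuous_clamp.
- by move=> t; apply: gX; exact: clamp_itv.
- by rewrite /= clamp_id ?lexx ?ler01.
- by rewrite /= clamp_id ?lexx ?ler01.
- move=> s t s0 t1; apply: eq_path_length => u /andP[su ut] /=.
  by rewrite clamp_id// (le_trans s0)//= (le_trans ut).
Qed.

Lemma intrinsic_dist_sym_le x y : (d y x <= d x y)%E.
Proof.
apply: le_ereal_inf_tmp => _ [g /path_clamp[cg gX <- <- <-//] <-].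
have /= := @intrinsic_dist_le_length ((g \o clamp) \o (fun t => -1 * t + 1)).
rewrite mulr0 add0r mulr1 addNr => /(_ _ _)/le_trans; apply => //.
- by apply: continuous_compose cg; exact: affine_continuous.
- by move=> u; exact: gX.
have := @path_length_rev _ _ (g \o clamp) (fun t => -1 * t + 1) 0 1.
rewrite mulr0 add0r mulr1 addNr; apply => s t st; lra.
Qed.

Lemma intrinsic_dist_sym x y : d x y = d y x.
Proof. by apply/eqP; rewrite eq_le !intrinsic_dist_sym_le. Qed.

Context (geo : 'rV[R]_m -> 'rV[R]_m -> R -> 'rV[R]_m)
  (geo_choice : geodesic_choice X geo) (X_finite : intrinsic_finite X).

(** When both right-hand distances are finite, minimizing geodesics attain them and their
    concatenation is a competitor for [d x z]. *)
Lemma intrinsic_dist_triangle x y z : (d x z <= d x y + d y z)%E.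
Proof.
have [->|] := eqVneq (d x y) +oo%E.
  by rewrite addye ?leey// gt_eqF// (lt_le_trans _ (intrinsic_dist_ge0 _ _)).
have [->|] := eqVneq (d y z) +oo%E.
  by rewrite addey ?leey// gt_eqF// (lt_le_trans _ (intrinsic_dist_ge0 _ _)).
have fin u v : d u v != +oo%E -> X u /\ X v.
  move=> uv; apply: (@intrinsic_dist_le_fin _ _ (fine (d u v))).
  by rewrite fineK// ge0_fin_numE ?intrinsic_dist_ge0// ltey.
move=> /fin[Xy Xz] /fin[Xx _].
have [/path_clamp[cg gX g0 g1 gl] <- _] := geo_choice Xx Xy.
have [/path_clamp[ch hX h0 h1 hl] <- _] := geo_choice Xy Xz.
rewrite -gl// -hl//; set g := geo x y \o clamp; set h := geo y z \o clamp.
have gh : g 1 = h 0 by rewrite /g /h g1 h0.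
apply: le_trans (path_length_concat gh).
have := @intrinsic_dist_le_length (concat g h).
rewrite concat0 concat1 /g /h g0 h1; apply; first exact: concat_continuous.
by move=> t; rewrite /concat; case: ifP.
Qed.

(** The piece of the geodesic between times [s] and [t], rescaled to the unit interval, is a path
    whose length is proportional to [t - s]. *)
Lemma intrinsic_dist_geodesic x y s t : X x -> X y ->
  0 <= s -> s <= t -> t <= 1 ->
  (d (geo x y s) (geo x y t) <= (t - s)%:E * d x y)%E.
Proof.
move=> Xx Xy s0 st t1.
have [pg <- <-//] := geo_choice Xx Xy.
have [cg gX g0 g1 gl] := path_clamp pg.
have : (d ((geo x y \o clamp) s) ((geo x y \o clamp) t) <=
    path_length (geo x y \o clamp) s t)%E.
  (* For [s = t] the rescaling would be constant, not strictly increasing, so this case is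
     separate. *)
  move: st; rewrite le_eqVlt => /predU1P[->|st].
    by rewrite path_lengthxx intrinsic_distxx.
  have := @intrinsic_dist_le_length ((geo x y \o clamp) \o (fun u => (t - s) * u + s)).
  rewrite [in X in (X <= _)%E]/comp mulr0 add0r mulr1 subrK => /(_ _ _)/le_trans; apply => //.
  - by apply: continuous_compose cg; exact: affine_continuous.
  - by move=> u; exact: gX.
  have := @path_length_map _ _ (geo x y \o clamp) _ (fun u => (t - s) * u + s) 0 1.
  rewrite mulr0 add0r mulr1 subrK; apply => // u v uv.
  by rewrite ltrD2r ltr_pM2l// subr_gt0.
rewrite gl//= !clamp_id//; last by rewrite s0 (le_trans st).
by rewrite (le_trans s0).
Qed.

Lemma geodesic_in x y t : X x -> X y -> 0 <= t <= 1 -> X (geo x y t).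
Proof. by move=> Xx Xy t01; have [[_ _ _ gX] _ _] := geo_choice Xx Xy; exact: gX. Qed.

Lemma geodesic0 x y : X x -> X y -> geo x y 0 = x.
Proof. by move=> Xx Xy; have [[]] := geo_choice Xx Xy. Qed.

Lemma geodesic1 x y : X x -> X y -> geo x y 1 = y.
Proof. by move=> Xx Xy; have [[]] := geo_choice Xx Xy. Qed.

Lemma intrinsic_dist_eq0 x y : (d x y <= 0)%E -> x = y.
Proof.
move=> xy; apply/esym/eqP; rewrite -subr_eq0; apply/eqP/enorm_eq0.
apply/eqP; rewrite eq_le enorm_ge0 andbT -lee_fin.
exact: le_trans (enorm_le_dist _ _) xy.
Qed.

Lemma geodesicxx x t : X x -> 0 <= t <= 1 -> geo x x t = x.
Proof.
move=> Xx /andP[t0 t1]; apply/esym/intrinsic_dist_eq0.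
have := intrinsic_dist_geodesic Xx Xx (lexx 0) t0 t1.
by rewrite geodesic0// (intrinsic_distxx Xx) mule0.
Qed.

(** The sup norm is dominated by the Euclidean norm, and the latter by the intrinsic distance. *)
Lemma intrinsic_val_continuous : continuous (\val : intrinsic_space X -> 'rV[R]_m).
Proof.
move=> x A /nbhs_ballP[e /= e0 eA].
rewrite /= nbhsE; exists [set y : intrinsic_space X | (d (\val x) (\val y) < e%:E)%E].
  split.
    move=> y /= xy; exists (e - fine (d (\val x) (\val y))).
      rewrite subr_gt0 -lte_fin fineK// ge0_fin_numE ?intrinsic_dist_ge0//.
      exact: lt_trans xy (ltry _).
    move=> z yz; apply: le_lt_trans (intrinsic_dist_triangle _ (\val y) _) _.
    have fy : d (\val x) (\val y) \is a fin_num.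
      rewrite ge0_fin_numE ?intrinsic_dist_ge0//; exact: lt_trans xy (ltry _).
    by rewrite -(fineK fy) -lteBrDl ?EFinB in yz *.
  by rewrite /= intrinsic_distxx//; exact: set_valP.
move=> y /= xy; apply: eA; rewrite -ball_normE/= distrC.
apply: le_lt_trans (normr_le_enorm _) _; rewrite -lte_fin.
exact: le_lt_trans (enorm_le_dist _ _) xy.
Qed.

(** The ball is closed for the intrinsic topology, hence compact there; its continuous image in the
    ambient space is compact, so closed. This makes balls Borel and their pullbacks along paths
    closed. *)
Lemma intrinsic_ball_closed x r :
  intrinsic_compact X -> closed (intrinsic_ball X x r).
Proof.
move=> cX.
have -> : intrinsic_ball X x r =
    (\val : intrinsic_space X -> 'rV[R]_m) @`
      [set y : intrinsic_space X | (d x (\val y) <= r%:E)%E].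
  apply/seteqP; split => [y xy|_ [y xy <-]//].
  by exists (set_elt (intrinsic_dist_le_fin xy).2).
apply: compact_closed; first exact: norm_hausdorff.
apply: continuous_compact.
  by apply: continuous_subspaceT; exact: intrinsic_val_continuous.
apply: subclosed_compact cX _ => //.
rewrite -[X in closed X]setCK; apply: open_closedC.
change (@intrinsic_open R m X
  (~` [set y : intrinsic_space X | (d x (\val y) <= r%:E)%E])).
(* Outside the ball, the excess [d x y - r] is a radius that keeps away from the ball; for [x]
   outside [X] the ball is empty and any radius works. *)
move=> y /= /negP; rewrite -ltNge => ry.
have [Xx|nXx] := pselect (X x); last first.
  by exists 1 => // z _ /intrinsic_dist_le_fin[].
have fy : d x (\val y) \is a fin_num by apply: X_finite => //; exact: set_valP.
exists (fine (d x (\val y)) - r).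
  by rewrite subr_gt0 -lte_fin fineK.
move=> z yz xz; move: yz; rewrite EFinB fineK// => yz.
have := intrinsic_dist_triangle x (\val z) (\val y).
rewrite leNgt => /negP; apply.
rewrite (intrinsic_dist_sym (\val z)).
apply: (@le_lt_trans _ _ (r%:E + d (\val y) (\val z))%E); first exact: leeD2r.
by rewrite -lteBrDl.
Qed.

End intrinsic_metric.

(** * Interleaving the Reeb graph with the graph of a dense sample *)

Section interleavings_from_maps.
Context {R : realType}.

(** No continuity of [F] is assumed: it suffices that [F] respects path components of interval
    preimages up to thickening. This covers the discontinuous choice of nearby sample points. *)
Lemma nattrans_from_map (T T' : topologicalType) (g : T -> R) (g' : T' -> R)
    (e : {nonneg R}) (F : T -> T')
    (Fval : forall I t, itv_set I (g t) -> itv_set (thicken e I) (g' (F t))) :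
  (forall I t t', joined R (g @^-1` itv_set I) t t' ->
     joined R (g' @^-1` itv_set (thicken e I)) (F t) (F t')) ->
  exists phi : nattrans (pi0_cosheaf g) (Defs.shift e (pi0_cosheaf g')),
    forall I (x : g @^-1` itv_set I),
      phi I (\pi_(pi0 R (g @^-1` itv_set I)) x) =
      \pi_(pi0 R (g' @^-1` itv_set (thicken e I)))
        (set_elt (A := g' @^-1` itv_set (thicken e I)) (Fval I _ (set_valP x))).
Proof.
move=> Fjoin.
pose phi I (c : pi0_cosheaf g I) : Defs.shift e (pi0_cosheaf g') I :=
  \pi_(pi0 R (g' @^-1` itv_set (thicken e I)))
    (set_elt (A := g' @^-1` itv_set (thicken e I))
      (Fval I _ (set_valP (repr (c : pi0 R (g @^-1` itv_set I)))))).
have phiE I (x : g @^-1` itv_set I) :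
    phi I (\pi_(pi0 R (g @^-1` itv_set I)) x) =
    \pi_(pi0 R (g' @^-1` itv_set (thicken e I)))
      (set_elt (A := g' @^-1` itv_set (thicken e I)) (Fval I _ (set_valP x))).
  rewrite /phi; apply/pi0_eqP => /=; apply: Fjoin; apply/pi0_eqP.
  by rewrite reprK.
have phi_nat I J (h : itv_le I J) (c : pi0_cosheaf g I) :
    phi J (pc_map h c) = pc_map h (phi I c).
  rewrite -[c](reprK (c : pi0 R (g @^-1` itv_set I))).
  set x := repr _.
  transitivity (phi J (\pi_(pi0 R (g @^-1` itv_set J))
      (set_incl (preimage_itv_sub h) x))).
    by congr (phi J _); exact: pi0_map_pi.
  rewrite (phiE J) (phiE I).
  apply: etrans (esym (pi0_map_pi (preimage_itv_sub (thicken_le e h)) _)).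
  by congr (\pi_(_) _); exact: eq_sig_hprop.
by exists (NatTrans phi_nat).
Qed.

(** On components, the interleaving identities only require each point to be joined to its image
    under the round trip, over the doubly thickened interval. *)
Lemma interleaved_from_maps (T T' : topologicalType) (g : T -> R) (g' : T' -> R)
    (e : {nonneg R}) (F : T -> T') (F' : T' -> T) :
  (forall I t, itv_set I (g t) -> itv_set (thicken e I) (g' (F t))) ->
  (forall I t t', joined R (g @^-1` itv_set I) t t' ->
     joined R (g' @^-1` itv_set (thicken e I)) (F t) (F t')) ->
  (forall I t, itv_set I (g' t) -> itv_set (thicken e I) (g (F' t))) ->
  (forall I t t', joined R (g' @^-1` itv_set I) t t' ->
     joined R (g @^-1` itv_set (thicken e I)) (F' t) (F' t')) ->
  (forall I t, itv_set I (g t) ->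
     joined R (g @^-1` itv_set (thicken e (thicken e I))) (F' (F t)) t) ->
  (forall I t, itv_set I (g' t) ->
     joined R (g' @^-1` itv_set (thicken e (thicken e I))) (F (F' t)) t) ->
  interleaved e (pi0_cosheaf g) (pi0_cosheaf g').
Proof.
move=> Fval Fjoin F'val F'join F'F FF'.
have [phi phiE] := nattrans_from_map Fval Fjoin.
have [psi psiE] := nattrans_from_map F'val F'join.
exists phi, psi; split=> I h c.
  rewrite -[c](reprK (c : pi0 R (g @^-1` itv_set I))) phiE psiE /= pi0_map_pi.
  apply/pi0_eqP; exact: (F'F I (\val (repr c)) (set_valP (repr c))).
rewrite -[c](reprK (c : pi0 R (g' @^-1` itv_set I))) psiE phiE /= pi0_map_pi.
apply/pi0_eqP; exact: (FF' I (\val (repr c)) (set_valP (repr c))).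
Qed.

Lemma thicken_near (e : {nonneg R}) (I : Defs.interval R) (r r' : R) :
  itv_set I r -> `|r' - r| <= e%:num -> itv_set (thicken e I) r'.
Proof.
case: I => [l h lh]; rewrite /itv_set /= => /andP[lr rh].
rewrite ler_norml => /andP[rr' r'r]; apply/andP; split.
  case: l lr {lh} => [l|//|_]; last by rewrite /= ltNyr.
  by rewrite -EFinD !lte_fin => lr; lra.
case: h rh {lh} => [h|_|//]; last by rewrite /= ltry.
by rewrite -EFinD !lte_fin => rh; lra.
Qed.

Lemma itv_set_is_interval (I : Defs.interval R) : is_interval (itv_set I).
Proof.
move=> x y /andP[lx _] /andP[_ yh] z /andP[xz zy].
rewrite /itv_set/= (lt_le_trans lx) ?lee_fin//.
by rewrite (le_lt_trans _ yh)// lee_fin.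
Qed.

Lemma open_itv_set (I : Defs.interval R) : open (itv_set I).
Proof.
case: I => [l h lh]; rewrite (_ : itv_set _ =
    [set r | (l < r%:E)%E] `&` [set r | (r%:E < h)%E]); last first.
  by apply/seteqP; split => r /=; [move=> /andP[]|case=> lr rh; apply/andP].
apply: openI.
- case: l {lh} => [l| |].
  + under eq_set do rewrite lte_fin; exact: open_gt.
  + rewrite (_ : [set _ | _] = set0); first exact: open0.
    by apply/seteqP; split.
  + rewrite (_ : [set _ | _] = setT); first exact: openT.
    by apply/seteqP; split => // r _ /=; rewrite ltNyr.
- case: h {lh} => [h| |].
  + under eq_set do rewrite lte_fin; exact: open_lt.
  + rewrite (_ : [set _ | _] = setT); first exact: openT.
    by apply/seteqP; split => // r _ /=; rewrite ltry.
  + rewrite (_ : [set _ | _] = set0); first exact: open0.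
    by apply/seteqP; split.
Qed.

End interleavings_from_maps.

(** * The realization of the sample graph and its maps to and from [X] *)

Section geometric_graph.
Context {R : realType} {m : nat} (X : set 'rV[R]_m) (f : 'rV[R]_m -> R)
  (geo : 'rV[R]_m -> 'rV[R]_m -> R -> 'rV[R]_m).
Hypotheses (X_finite : intrinsic_finite X)
  (geo_choice : geodesic_choice X geo).
Context (delta : R) (S : set 'rV[R]_m).
Hypotheses (delta_gt0 : 0 < delta) (S_finite : finite_set S) (SX : S `<=` X).

Local Notation V := 'rV[R]_m.
Local Notation d := (intrinsic_dist X).
Local Notation G := (realization X delta S).
Local Notation fh := (@pl_extension R m X delta S f).

Lemma edge_point_xx (x : V) t : edge_point x x t = edge_point x x 0.
Proof. by apply/funext => z; rewrite /edge_point -mulrDl; ring. Qed.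

Lemma edge_point0 (x y : V) : edge_point x y 0 = edge_point x x 0.
Proof. by apply/funext => z; rewrite /edge_point; ring. Qed.

Lemma edge_point1 (x y : V) : edge_point x y 1 = edge_point y y 0.
Proof. by apply/funext => z; rewrite /edge_point; ring. Qed.

Lemma edge_point_swap (x y : V) t : edge_point x y t = edge_point y x (1 - t).
Proof. by apply/funext => z; rewrite /edge_point; ring. Qed.

Lemma edge_pointr (x y : V) t : x != y -> edge_point x y t y = t.
Proof.
by move=> xy; rewrite /edge_point eq_sym (negbTE xy) eqxx mulr0 mulr1 add0r.
Qed.

Lemma edge_pointl (x y : V) t : x != y -> edge_point x y t x = 1 - t.
Proof.
by move=> xy; rewrite /edge_point (negbTE xy) eqxx mulr0 mulr1 addr0.
Qed.

(** The case [x = y] is allowed, so that vertices are points of degenerate edges and every point of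
    the realization is treated alike. *)
Definition adjacent (x y : V) := [/\ S x, S y & (d x y <= (2 * delta)%:E)%E].

Lemma adjacent_xx x : S x -> adjacent x x.
Proof.
move=> Sx; split => //; rewrite intrinsic_distxx; last exact: SX.
by rewrite lee_fin mulr_ge0// ltW.
Qed.

Lemma adjacent_sym x y : adjacent x y -> adjacent y x.
Proof. by move=> [Sx Sy xy]; split => //; rewrite intrinsic_dist_sym. Qed.

Lemma realization_adjacent x y t : adjacent x y -> 0 <= t <= 1 ->
  G (edge_point x y t).
Proof.
move=> [Sx Sy xy] t01; exists x, y, t; split => //.
have [->|/eqP xny] := eqVneq x y; first by left.
by right; split.
Qed.

Lemma realizationP (c : G) : exists x y t,
  [/\ adjacent x y, 0 <= t <= 1 & \val c = edge_point x y t].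
Proof.
have [x [y [t [Sx Sy xy t01 ->]]]] : G (\val c) by exact: set_valP.
exists x, y, t; split => //; case: xy => [<-|[_ xy]]; last by split.
exact: adjacent_xx.
Qed.

Lemma pl_extensionE (c : G) x y t : S x -> S y -> \val c = edge_point x y t ->
  fh c = (1 - t) * f x + t * f y.
Proof.
move=> Sx Sy cE; rewrite /pl_extension cE.
have sum1 x0 (k : R) : S x0 -> \sum_(z \in S) (k * (z == x0)%:R * f z) = k * f x0.
  move=> Sx0; rewrite (fsbigD1 x0)//= eqxx mulr1 fsbig1 ?addr0//.
  by move=> z [_ /= /eqP/negbTE ->]; rewrite mulr0 mul0r.
rewrite -(sum1 x)// -(sum1 y)// -fsbig_split//=.
by apply: eq_fsbigr => z _; rewrite /edge_point mulrDl.
Qed.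

Lemma edge_point_continuous (x y : V) : continuous (edge_point x y).
Proof.
move=> t; apply/pointwise_cvgP => z.
have : {for t, continuous (fun u => edge_point x y u z)}; last exact.
rewrite (_ : (fun _ => _) =
    (fun u : R => ((z == y)%:R - (z == x)%:R) * u + (z == x)%:R)).
  exact: affine_continuous.
by apply/funext => u; rewrite /edge_point; ring.
Qed.

(** The extension is affine along the edge, so between two parameters its values lie between the two
    end values and thus in the interval [J]. *)
Lemma joined_edge (J : set R) (c c' : G) x y s t :
  is_interval J -> adjacent x y -> 0 <= s <= 1 -> 0 <= t <= 1 ->
  \val c = edge_point x y s -> \val c' = edge_point x y t ->
  J (fh c) -> J (fh c') -> joined R (fh @^-1` J) c c'.
Proof.
move=> iJ xy s01 t01 cE c'E Jc Jc'.
have [Sx Sy _] := xy.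
have cl01 (u : R) : 0 <= clamp u <= 1 by have := clamp_itv u; rewrite in_itv.
pose g u : G := set_elt (realization_adjacent xy (cl01 u)).
have gE u : fh (g u) = (1 - clamp u) * f x + clamp u * f y.
  exact: pl_extensionE.
have -> : c = g s by apply: val_inj; rewrite cE /= clamp_id.
have -> : c' = g t by apply: val_inj; rewrite c'E /= clamp_id.
rewrite (pl_extensionE Sx Sy cE) in Jc.
rewrite (pl_extensionE Sx Sy c'E) in Jc'.
apply: joined_along.
  apply: continuous_subtype.
  apply: (continuous_compose (h := edge_point x y)).
    exact: clamp_continuous.
  exact: edge_point_continuous.
move=> u /andP[stu ust].
have /andP[s0 s1] := s01; have /andP[t0 t1] := t01.
have u01 : 0 <= u <= 1.
  move: stu ust; rewrite ge_min le_max => su us.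
  by apply/andP; split; [case/orP : su|case/orP : us] => ?; lra.
rewrite /preimage/= gE (clamp_id u01).
move: stu ust; rewrite ge_min le_max.
have [fxy|/ltW fyx] := leP (f x) (f y); have [st|/ltW ts] := leP s t.
- move=> su us; apply: (iJ _ _ Jc Jc'); apply/andP.
  by split; [case/orP : su|case/orP : us] => ?; nra.
- move=> su us; apply: (iJ _ _ Jc' Jc); apply/andP.
  by split; [case/orP : su|case/orP : us] => ?; nra.
- move=> su us; apply: (iJ _ _ Jc' Jc); apply/andP.
  by split; [case/orP : us|case/orP : su] => ?; nra.
- move=> su us; apply: (iJ _ _ Jc Jc'); apply/andP.
  by split; [case/orP : us|case/orP : su] => ?; nra.
Qed.

Definition vertex x (Sx : S x) : G :=
  set_elt (realization_adjacent (t := 0) (adjacent_xx Sx)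
    (introT andP (conj (lexx 0) ler01))).

Lemma pl_extension_vertex x (Sx : S x) : fh (vertex Sx) = f x.
Proof. by rewrite (@pl_extensionE _ x x 0)//; ring. Qed.

Lemma joined_vertex (J : set R) x y (Sx : S x) (Sy : S y) :
  is_interval J -> (d x y <= (2 * delta)%:E)%E -> J (f x) -> J (f y) ->
  joined R (fh @^-1` J) (vertex Sx) (vertex Sy).
Proof.
move=> iJ xy Jx Jy.
apply: (@joined_edge _ _ _ x y 0 1) => //; rewrite ?lexx ?ler01//=.
- by rewrite (edge_point0 x y).
- by rewrite (edge_point1 x y).
- by rewrite pl_extension_vertex.
- by rewrite pl_extension_vertex.
Qed.

Lemma edge_point_support (x y z : V) t :
  edge_point x y t z != 0 -> z = x \/ z = y.
Proof.
rewrite /edge_point; have [->|zx] := eqVneq z x; first by left.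
have [->|zy] := eqVneq z y; first by right.
by rewrite !mulr0 addr0 eqxx.
Qed.

(** Comparing barycentric coordinates leaves only an endpoint of the edge, or a degenerate edge
    whose geodesic is constant. *)
Lemma geodesic_vertex (a x y : V) t : adjacent x y -> 0 <= t <= 1 ->
  edge_point x y t = edge_point a a 0 -> geo x y t = a.
Proof.
move=> [/SX Xx /SX Xy _] t01; have [<-|xy] := eqVneq x y => e.
  rewrite (geodesicxx geo_choice)//; have [//|xa] := eqVneq x a.
  have /= := congr1 (fun c : V -> R => c a) e.
  rewrite /edge_point eqxx (eq_sym a x) (negbTE xa) !mulr0 mulr1 mul0r subr0 !addr0.
  by move=> /eqP; rewrite eq_sym oner_eq0.
have := congr1 (fun c : V -> R => c x) e; have := congr1 (fun c : V -> R => c y) e.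
rewrite edge_pointl// edge_pointr// /edge_point mul0r subr0 !mul1r !addr0.
have [<-|_] := eqVneq x a.
  move=> _ /= t0; have -> : t = 0 by lra.
  exact: (geodesic0 geo_choice).
have [<- /= t1 _|_ /= t0 t1] := eqVneq y a; last by exfalso; lra.
have -> : t = 1 by lra.
exact: (geodesic1 geo_choice).
Qed.

(** A point that is not a vertex determines its edge as the support of its coordinates, the
    orientation fixes the order of the endpoints, and the parameter is the coordinate at [y].
    Vertices fall under [geodesic_vertex]. *)
Lemma edge_point_oriented_inj (ord : rel V) (x y x' y' : V) t t' :
  (forall a b, S a -> S b -> ord a b -> ord b a -> a = b) ->
  adjacent x y -> ord x y -> 0 <= t <= 1 ->
  adjacent x' y' -> ord x' y' -> 0 <= t' <= 1 ->
  edge_point x y t = edge_point x' y' t' -> geo x y t = geo x' y' t'.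
Proof.
move=> anti a o t01 a' o' t01' e.
have vtx b : edge_point x y t = edge_point b b 0 -> geo x y t = geo x' y' t'.
  by move=> eb; rewrite (geodesic_vertex a t01 eb) (geodesic_vertex a' t01' (etrans (esym e) eb)).
have [xy|xy] := eqVneq x y.
  by apply: (vtx x); rewrite -xy edge_point_xx.
have [xy'|xy'] := eqVneq x' y'.
  by apply: (vtx x'); rewrite e -xy' edge_point_xx.
have [t0|t0] := eqVneq t 0; first by apply: (vtx x); rewrite t0 edge_point0.
have [t1|t1] := eqVneq t 1; first by apply: (vtx y); rewrite t1 edge_point1.
have [|xx'|xy'x] := @edge_point_support x' y' x t'.
- by rewrite -e edge_pointl// subr_eq0 eq_sym.
- have [|yx'|yy'] := @edge_point_support x' y' y t'.
  + by rewrite -e edge_pointr.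
  + by move: xy; rewrite xx' yx' eqxx.
  + rewrite -xx' -yy'; congr (geo x y _).
    by rewrite -(edge_pointr t xy) e yy' edge_pointr.
- have [|yx'|yy'] := @edge_point_support x' y' y t'.
  + by rewrite -e edge_pointr.
  (* Here the two presentations use the same edge with opposite orientations, against
     antisymmetry. *)
  + have [Sx Sy _] := a; move: xy; rewrite (anti x y) ?eqxx//.
    by rewrite xy'x yx'.
  + by move: xy; rewrite xy'x yy' eqxx.
Qed.

(* Edges are mapped to geodesics. As [geo y x] need not be the reverse of
   [geo x y], each edge is first oriented, by the position of its endpoints in
   an enumeration of [S]. *)
Lemma geodesic_map : exists Phi : G -> X,
  continuous Phi /\
  forall c, exists x y t, [/\ adjacent x y, 0 <= t <= 1,
    \val c = edge_point x y t & \val (Phi c) = geo x y t].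
Proof.
have [s sS] : exists s : seq V, S = [set` s] by exact/finite_seqP.
pose ord (x y : V) := (index x s <= index y s)%N.
have ord_anti x y : S x -> S y -> ord x y -> ord y x -> x = y.
  rewrite sS /= => xs ys xy yx; rewrite -(nth_index x xs) -[RHS](nth_index x ys).
  by congr nth; apply/eqP; rewrite eqn_leq; apply/andP.
have oriented (c : G) : exists x y t, [/\ adjacent x y, ord x y, 0 <= t <= 1 &
    \val c = edge_point x y t].
  have [x [y [t [xy t01 ->]]]] := realizationP c.
  have [oxy|/ltnW oyx] := leqP (index x s) (index y s); first by exists x, y, t.
  exists y, x, (1 - t); split => //; first exact: adjacent_sym.
    by move: t01 => /andP[t0 t1]; apply/andP; split; lra.
  exact: edge_point_swap.
(* The value is required to agree with all oriented presentations of [c] at once, which makes the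
   formula for [Phi] available on every edge containing [c]. *)
have /choice[Phi PhiE] : forall c : G, exists z : X, forall x y t,
    adjacent x y -> ord x y -> 0 <= t <= 1 -> \val c = edge_point x y t ->
    \val z = geo x y t.
  move=> c; have [x [y [t [xy oxy t01 cE]]]] := oriented c.
  have [Sx Sy _] := xy.
  exists (set_elt (geodesic_in geo_choice (SX Sx) (SX Sy) t01)).
  move=> x' y' t' xy' oxy' t01' cE' /=.
  by apply: (edge_point_oriented_inj ord_anti) => //; rewrite -cE.
exists Phi; split; last first.
  move=> c; have [x [y [t [xy oxy t01 cE]]]] := oriented c.
  by exists x, y, t; split => //; exact: PhiE.
apply: continuous_subtype.
(* Pasting over the finitely many oriented edges: each is closed as a compact subset of a Hausdorff
   space, and on it the parameter is recovered continuously as the coordinate at the second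
   endpoint. *)
apply: (@continuous_finite_closed_cover G V (V * V)%type
  [set p | adjacent p.1 p.2 /\ ord p.1 p.2]
  (fun p => \val @^-1` (edge_point p.1 p.2 @` `[0, 1]))
  (fun p c => geo p.1 p.2 (clamp ((\val c : V -> R) p.2)))).
- apply: (@sub_finite_set _ _ (S `*` S)); last exact: finite_setX.
  by move=> p [[Sx Sy _] _].
- move=> p _.
  have /continuous_closedP : continuous (\val : G -> {ptws V -> R}).
    exact: continuous_val.
  apply; apply: compact_closed.
    by apply: hausdorff_product => x; exact: norm_hausdorff.
  apply: continuous_compact; last exact: segment_compact.
  by apply: continuous_subspaceT; exact: edge_point_continuous.
- move=> [x y] [/= [/SX Xx /SX Xy _] _].
  have [[cg _ _ _] _ _] := geo_choice Xx Xy.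
  apply: (continuous_compose (g := fun c : G => (\val c : V -> R) y)
    (h := geo x y \o clamp)); last exact: continuous_clamp.
  apply: (continuous_compose (g := \val : G -> {ptws V -> R})
    (h := fun c : {ptws V -> R} => c y)); first exact: continuous_val.
  exact: (@proj_continuous V (fun=> R) y).
- move=> c; have [x [y [t [xy oxy t01 cE]]]] := oriented c.
  by exists (x, y) => //=; exists t; rewrite ?in_itv.
- move=> [x y] c [/= xy oxy] [t /=]; rewrite in_itv/= => t01 cE.
  (* On a degenerate edge the coordinate at [y] is [1] whatever [t] is; this is harmless because the
     geodesic is constant. *)
  rewrite (PhiE c x y t)// -cE; have [exy|nxy] := eqVneq x y.
    have [/SX Xx _ _] := xy; rewrite -exy !(geodesicxx geo_choice)//.
    by have := clamp_itv (edge_point x x t x); rewrite in_itv.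
  by rewrite edge_pointr// clamp_id.
Qed.

Context (e : {nonneg R}).
Hypotheses
  (X_compact : intrinsic_compact X)
  (S_cover : forall z, X z -> exists2 s, S s & (d s z <= delta%:E)%E)
  (f_near : forall x y, X x -> X y -> (d x y <= delta%:E)%E ->
     `|f x - f y| <= e%:num).

(** Independence of all choices for the map from [X] to the graph: any sample points near the two
    ends of a path have vertices in the same component. *)
Lemma joined_near_vertices (I : Defs.interval R) (x x' : X) s s'
    (Ss : S s) (Ss' : S s') :
  joined R (restr X f @^-1` itv_set I) x x' ->
  (d s (\val x) <= delta%:E)%E -> (d s' (\val x') <= delta%:E)%E ->
  joined R (fh @^-1` itv_set (thicken e I)) (vertex Ss) (vertex Ss').
Proof.
move=> /joinedP[g [cg g0 g1 gI]] sx s'x'.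
(* Sample points within [delta] of the same point are within [2 * delta] of each other, and their
   heights stay in the thickened interval. *)
have common t s1 s2 (S1 : S s1) (S2 : S s2) :
    (d s1 (\val (g t)) <= delta%:E)%E -> (d s2 (\val (g t)) <= delta%:E)%E ->
    joined R (fh @^-1` itv_set (thicken e I)) (vertex S1) (vertex S2).
  move=> d1 d2; have Xg : X (\val (g t)) by exact: set_valP.
  apply: joined_vertex.
  - exact: itv_set_is_interval.
  - apply: le_trans (intrinsic_dist_triangle geo_choice _ (\val (g t)) _) _.
    rewrite (intrinsic_dist_sym _ (\val (g t)) s2).
    by rewrite (_ : 2 * delta = delta + delta) ?EFinD ?leeD//; ring.
  - by apply: thicken_near (gI t) _; apply: f_near => //; exact: SX.
  - by apply: thicken_near (gI t) _; apply: f_near => //; exact: SX.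
pose P s1 := exists S1 : S s1,
  joined R (fh @^-1` itv_set (thicken e I)) (vertex Ss) (vertex S1).
pose near_of (Q : set V) := [set t | exists2 s1, (S `&` Q) s1 &
  (d s1 (\val (g t)) <= delta%:E)%E].
have closed_near Q : closed (near_of Q).
  rewrite (_ : near_of Q = \bigcup_(s1 in S `&` Q)
      ((fun t => \val (g t)) @^-1` intrinsic_ball X s1 delta)).
    apply: closed_bigcup; first by apply: sub_finite_set S_finite => ? [].
    move=> s1 _; have /continuous_closedP : continuous (fun t => \val (g t)).
      apply: (continuous_compose (h := \val : X -> V)) => //.
      exact: continuous_val.
    by apply; exact: (intrinsic_ball_closed geo_choice).
  by apply/seteqP; split => t; [move=> [s1 ? ?]; exists s1|move=> [s1 ? ?]; exists s1].
(* Density of [S] makes the two closed sets of times cover the line, and [common] makes them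
   disjoint. *)
have nearP : ~` near_of P = near_of (~` P).
  apply/seteqP; split => t.
    have [s1 S1 s1g] := S_cover (set_valP (g t)).
    by move=> nP; exists s1 => //; split => // Ps1; apply: nP; exists s1.
  move=> [s2 [S2 nPs2] s2g] [s1 [_ [S1 ss1]] s1g]; apply: nPs2.
  by exists S2; apply: joined_trans ss1 _; exact: common s1g s2g.
have /seteqP[_ /(_ 1 Logic.I)] : near_of P = setT.
  apply: connected_line.
  - by rewrite -[near_of P]setCK nearP; exact: closed_openC.
  - exact: closed_openC.
  - exists 0, s; last by rewrite g0.
    split => //; exists Ss; apply: joined_refl.
    apply: (@joinedl _ _ _ _ (vertex Ss)); apply: (common 0); by rewrite g0.
move=> [s1 [_ [S1 ss1]] s1g]; apply: joined_trans ss1 _.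
by apply: common s1g _; rewrite g1.
Qed.

Hypotheses (Xf_constructible : constructible (restr X f))
  (f_edge : forall x y, X x -> X y -> (d x y <= (2 * delta)%:E)%E ->
     2^-1 * `|f x - f y| <= e%:num)
  (f_geo : forall x y t, X x -> X y -> (d x y <= (2 * delta)%:E)%E ->
     0 <= t <= 1 -> `|f (geo x y t) - ((1 - t) * f x + t * f y)| <= e%:num).

Lemma joined_geodesic (J : set R) (x y : X) :
  (forall t, 0 <= t <= 1 -> J (f (geo (\val x) (\val y) t))) ->
  joined R (restr X f @^-1` J) x y.
Proof.
move=> gJ; have Xx : X (\val x) by exact: set_valP.
have Xy : X (\val y) by exact: set_valP.
have cl01 (u : R) : 0 <= clamp u <= 1 by have := clamp_itv u; rewrite in_itv.
apply/joinedP.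
exists (fun u => set_elt (geodesic_in geo_choice Xx Xy (cl01 u))); split.
- apply: continuous_subtype; have [[cg _ _ _] _ _] := geo_choice Xx Xy.
  exact: continuous_clamp cg.
- by apply: val_inj => /=; rewrite clamp_id ?lexx ?ler01// (geodesic0 geo_choice).
- by apply: val_inj => /=; rewrite clamp_id ?lexx ?ler01// (geodesic1 geo_choice).
- by move=> u; exact: gJ.
Qed.

Lemma geodesic_dist_left x y t : adjacent x y -> 0 <= t <= 2^-1 ->
  (d x (geo x y t) <= delta%:E)%E.
Proof.
move=> [/SX Xx /SX Xy xy] /andP[t0 t2].
have t1 : t <= 1 by lra.
have := intrinsic_dist_geodesic geo_choice Xx Xy (lexx 0) t0 t1.
rewrite (geodesic0 geo_choice)// => /le_trans; apply.
have /fineK dE := X_finite Xx Xy; move: xy; rewrite -dE subr0 -EFinM !lee_fin.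
have : 0 <= fine (d x y) by apply: fine_ge0; exact: intrinsic_dist_ge0.
by move=> d0 dxy; nra.
Qed.

Lemma geodesic_dist_right x y t : adjacent x y -> 2^-1 <= t <= 1 ->
  (d y (geo x y t) <= delta%:E)%E.
Proof.
move=> [/SX Xx /SX Xy xy] /andP[t2 t1].
have t0 : 0 <= t by lra.
have := intrinsic_dist_geodesic geo_choice Xx Xy t0 t1 (lexx 1).
rewrite (geodesic1 geo_choice)// intrinsic_dist_sym => /le_trans; apply.
have /fineK dE := X_finite Xx Xy; move: xy; rewrite -dE -EFinM !lee_fin.
have : 0 <= fine (d x y) by apply: fine_ge0; exact: intrinsic_dist_ge0.
by move=> d0 dxy; nra.
Qed.

Theorem reeb_interleaved :
  interleaved e (pi0_cosheaf (@reeb_fun R X (restr X f))) (pl_reeb X delta S f).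
Proof.
have [Phi [cPhi PhiE]] := geodesic_map.
have cf : continuous (restr X f) by case: Xf_constructible.
have ljX := locally_joined_constructible Xf_constructible.
(* [sm] picks an arbitrary nearby sample point, without any continuity. *)
have /choice[sm smP] : forall z : X, exists s, S s /\ (d s (\val z) <= delta%:E)%E.
  by move=> z; have [s Ss sz] := S_cover (set_valP z); exists s.
pose F (c : reeb_graph (restr X f)) : G := vertex (smP (repr c)).1.
pose F' (c : G) : reeb_graph (restr X f) := \pi_(reeb_graph (restr X f)) (Phi c).
have f_sm (z : X) : `|f (sm z) - f (\val z)| <= e%:num.
  have [Ss sz] := smP z; apply: f_near => //; first exact: SX.
  exact: set_valP.
have F'val I c : itv_set I (fh c) ->
    itv_set (thicken e I) (@reeb_fun R X (restr X f) (F' c)).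
  move=> cI; rewrite /F' reeb_fun_pi; apply: thicken_near cI _.
  have [x [y [t [xy t01 cE]]]] := PhiE c; rewrite /restr => ->.
  have [Sx Sy dxy] := xy; rewrite (pl_extensionE Sx Sy cE).
  by apply: f_geo => //; exact: SX.
apply: (@interleaved_from_maps _ _ _ _ _ _ F F').
- move=> I c cI; rewrite /F pl_extension_vertex; apply: thicken_near cI _.
  exact: f_sm.
- move=> I c c' cc'.
  have {}cc' := joined_reeb ljX cf (@open_itv_set _ I) cc'.
  by apply: joined_near_vertices cc' _ _; exact: (smP _).2.
- exact: F'val.
- move=> I c c' cc'; apply: (joined_image _ _ cc') => [|z]; last exact: F'val.
  by apply: continuous_compose => //; exact: pi_reeb_continuous.
(* From the Reeb graph and back: [Phi] sends the vertex of a sample point to that point, and the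
   geodesic from it to the original point stays within [delta] of the latter. *)
- move=> I c cI; rewrite -[X in joined _ _ _ X]reprK.
  apply: (joined_image (@pi_reeb_continuous _ _ (restr X f))
    (A := restr X f @^-1` itv_set (thicken e (thicken e I)))).
    by move=> z; rewrite /preimage/= reeb_fun_pi.
  have [Ss sz] := smP (repr c).
  have PhiF : \val (Phi (F c)) = sm (repr c).
    have [x [y [t [xy t01 cE ->]]]] := PhiE (F c).
    exact: geodesic_vertex.
  have Xs := SX Ss; have Xc : X (\val (repr c)) by exact: set_valP.
  apply: joined_geodesic => t /andP[t0 t1]; rewrite PhiF.
  apply: (@thicken_near _ _ _ (f (\val (repr c)))).
    by apply: itv_le_sub cI; exact: le_thicken.
  have t01 : 0 <= t <= 1 by rewrite t0.
  apply: f_near => //; first exact: (geodesic_in geo_choice).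
  have := intrinsic_dist_geodesic geo_choice Xs Xc t0 t1 (lexx 1).
  rewrite (geodesic1 geo_choice)// => /le_trans; apply.
  have /fineK dE := X_finite Xs Xc; move: sz; rewrite -dE -EFinM !lee_fin.
  have : 0 <= fine (d (sm (repr c)) (\val (repr c))).
    by apply: fine_ge0; exact: intrinsic_dist_ge0.
  by move=> ? ?; nra.
(* From the realization and back: the point [c] is compared with the endpoint of its edge nearer in
   parameter, which lies within [delta] of [Phi c]. *)
- move=> I c cI.
  have [x [y [t [xy t01 cE PhicE]]]] := PhiE c.
  have [Sx Sy dxy] := xy.
  have cIe : itv_set (thicken e I) (restr X f (Phi c)).
    by have := F'val I c cI; rewrite /F' reeb_fun_pi.
  have /reeb_eqP[fz jz] : \pi_(reeb_graph (restr X f)) (Phi c) =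
      \pi_(reeb_graph (restr X f)) (repr (F' c)) by rewrite reprK.
  have {}jz : joined R (restr X f @^-1` itv_set (thicken e I)) (repr (F' c)) (Phi c).
    apply: joined_sym; apply: joinedS jz => w; rewrite /preimage/= => ->.
    exact: cIe.
  have fhc := pl_extensionE Sx Sy cE.
  have fe := f_edge (SX Sx) (SX Sy) dxy.
  have end_near s0 (Ss0 : S s0) (s : R) : 0 <= s <= 1 ->
      edge_point s0 s0 0 = edge_point x y s ->
      (d s0 (\val (Phi c)) <= delta%:E)%E ->
      `|f s0 - fh c| <= e%:num ->
      joined R (fh @^-1` itv_set (thicken e (thicken e I))) (F (F' c)) c.
    move=> s01 s0E s0c fs0; apply: (joined_trans (y := vertex Ss0)).
      by apply: joined_near_vertices jz _ s0c; exact: (smP _).2.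
    have cI2 : itv_set (thicken e (thicken e I)) (fh c).
      by do 2![apply: itv_le_sub (le_thicken _ _) _ _]; exact: cI.
    apply: (@joined_edge _ _ _ x y s t) => //.
    + exact: itv_set_is_interval.
    + rewrite pl_extension_vertex; apply: (@thicken_near _ _ _ (fh c)) => //.
      by apply: itv_le_sub (le_thicken _ _) _ _.
  have [t2|/ltW t2] := leP t 2^-1.
    apply: (end_near x Sx 0); rewrite ?lexx ?ler01//.
    + by rewrite (edge_point0 x y).
    + rewrite PhicE; apply: geodesic_dist_left => //.
      by case/andP : t01 => ->.
    (* With [t] at most one half, the height changes by at most half the variation along the edge;
       this is the first term in [theta]. *)
    + rewrite fhc; have -> : f x - ((1 - t) * f x + t * f y) = t * (f x - f y) by ring.
      case/andP : t01 => t0 t1; apply: le_trans fe.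
      by rewrite normrM ger0_norm// ler_wpM2r.
  apply: (end_near y Sy 1); rewrite ?lexx ?ler01//.
  + by rewrite (edge_point1 x y).
  + rewrite PhicE; apply: geodesic_dist_right => //.
    by case/andP : t01 => _ ->; rewrite t2.
  + rewrite fhc; have -> : f y - ((1 - t) * f x + t * f y) = (t - 1) * (f x - f y) by ring.
    case/andP : t01 => t0 t1; apply: le_trans fe.
    rewrite normrM ler_wpM2r// ler0_norm ?subr_le0//; lra.
Qed.

End geometric_graph.

(** * Probability that the sample is dense *)

Lemma measure_bigsetU_le (d : measure_display) (T : measurableType d)
    (R : realType) (mu : {measure set T -> \bar R}) (I : Type) (s : seq I)
    (F : I -> set T) :
  (forall i, measurable (F i)) ->
  (mu (\big[setU/set0]_(i <- s) F i) <= \sum_(i <- s) mu (F i))%E.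
Proof.
move=> mF; elim: s => [|i s ih]; first by rewrite !big_nil measure0.
rewrite !big_cons (le_trans (measureU2 _ _ _))//; last exact: leeD2l.
exact: bigsetU_measurable.
Qed.

Lemma preimageT_measurable (d d' : measure_display) (T : measurableType d)
    (T' : measurableType d') (g : T -> T') (B : set T') :
  measurable_fun setT g -> measurable B -> measurable (g @^-1` B).
Proof. by move=> mg mB; rewrite -[_ @^-1` _]setTI; exact: mg. Qed.

Section borel_row_vectors.
Context {R : realType} {m : nat}.

Lemma open_borel (A : set 'rV[R]_m) : open A -> measurable (A : set (borel R m)).
Proof. by move=> oA; exact: sub_sigma_algebra. Qed.

Lemma closed_borel (A : set 'rV[R]_m) :
  closed A -> measurable (A : set (borel R m)).
Proof.
move=> cA; rewrite -[A]setCK; apply: measurableC; apply: open_borel.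
exact: closed_openC.
Qed.

(** Otherwise every point has a null open neighbourhood; finitely many of them cover each closed
    ball around the origin, and countably many balls exhaust the space, which would be null. *)
Lemma msupport_nonempty (P : probability (borel R m) R) : msupport P !=set0.
Proof.
apply/set0P/eqP => P0.
have null_nbhd x : exists U : set 'rV[R]_m, [/\ open U, U x & P U = 0%E].
  have : ~ msupport P x by rewrite P0.
  move=> /existsNP[U /not_implyP[oU /not_implyP[Ux PU]]]; exists U; split => //.
  by apply/eqP; rewrite eq_le measure_ge0 andbT leNgt; exact/negP.
have /choice[U UP] := null_nbhd.
pose K (k : nat) : set 'rV[R]_m := [set x | `|x| <= k%:R].
have cK k : compact (K k).
  apply: bounded_closed_compact.
    exists k%:R; split; first exact: num_real.
    by move=> M kM x xk; exact: le_trans xk (ltW kM).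
  have /continuous_closedP : continuous (@Num.norm R 'rV[R]_m).
    exact: norm_continuous.
  by move=> /(_ _ (@closed_le R k%:R)).
have nK k : P.-negligible (K k).
  have oU x : setT x -> open (U x) by move=> _; have [] := UP x.
  have KU : K k `<=` \bigcup_x U x by move=> x _; exists x => //; have [] := UP x.
  have := cK k; rewrite compact_cover => /(_ _ setT U oU KU)[D _ KD].
  move: KD; rewrite /cover; set W := \bigcup_(_ in _) _ => KW.
  have nW : P.-negligible (W : set (borel R m)).
    rewrite /W bigcup_fset; elim/big_ind : _.
    - exact: negligible_set0.
    - by move=> ? ?; exact: negligibleU.
    - move=> x _; have [oUx _ PU] := UP x.
      by apply/negligibleP => //; exact: open_borel.
  by apply: (negligibleS _ nW); exact: KW.
have : P.-negligible setT.
  rewrite (_ : setT = \bigcup_k K k); first exact: negligible_bigcup.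
  apply/esym/seteqP; split => // x _; exists (Num.truncn `|x|).+1 => //=.
  exact/ltW/truncnS_gt.
move=> /(negligibleP P measurableT).1 PT.
have : (1 = 0 :> \bar R)%E by rewrite -(probability_setT P); exact: PT.
by move=> /eqP; rewrite onee_eq0.
Qed.

End borel_row_vectors.

(** * Separated nets and the probability of missing a ball *)

Section standard_measure.
Context {R : realType} {m : nat} (X : set 'rV[R]_m)
  (geo : 'rV[R]_m -> 'rV[R]_m -> R -> 'rV[R]_m).
Hypotheses (X_finite : intrinsic_finite X)
  (geo_choice : geodesic_choice X geo) (X_compact : intrinsic_compact X).
Context (P : probability (borel R m) R) (a b : R).
Hypotheses (a_gt0 : 0 < a) (b_gt0 : 0 < b) (P_standard : standard X P a b).
Local Notation V := 'rV[R]_m.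
Local Notation d := (intrinsic_dist X).

Lemma ball_borel x r : measurable (intrinsic_ball X x r : set (borel R m)).
Proof. by apply: closed_borel; exact: (intrinsic_ball_closed geo_choice). Qed.

(** The radius solves [a * r ^ b = 1]. As balls lie in [X], this puts the sample in [X] almost
    surely by way of a Borel set. *)
Lemma standard_full x : X x ->
  exists2 r, 0 < r & P (intrinsic_ball X x r) = 1%E.
Proof.
move=> Xx; pose r := (a^-1) `^ (b^-1).
have r0 : 0 < r by rewrite powR_gt0 ?invr_gt0.
exists r => //; apply/eqP; rewrite eq_le; apply/andP; split.
  by apply: probability_le1; exact: ball_borel.
apply: le_trans (P_standard Xx r0); rewrite lee_fin le_min lexx andbT.
rewrite -powRrM mulVf ?lt0r_neq0// powRr1; last by rewrite invr_ge0 ltW.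
by rewrite divff// lt0r_neq0.
Qed.

Definition separated (r : R) (s : seq V) : Prop :=
  [/\ uniq s, forall x, x \in s -> X x &
      forall x y, x \in s -> y \in s -> x != y -> ~ (d x y <= r%:E)%E].

(** The balls of radius [r] around the points are disjoint, so their masses add up to at most
    one. *)
Lemma separated_size (r : R) (s : seq V) : 0 < r -> separated (r + r) s ->
  (size s)%:R * Num.min (a * r `^ b) 1 <= 1.
Proof.
move=> r0 [us sX ssep].
have disj : trivIset [set` s] (fun x => intrinsic_ball X x r).
  apply/trivIsetP => x y /= xs ys xy; apply/seteqP; split => // z [xz yz].
  apply: (ssep x y xs ys xy).
  apply: le_trans (intrinsic_dist_triangle geo_choice _ z _) _.
  by rewrite (intrinsic_dist_sym _ z) EFinD leeD.
have mB x : [set` s] x -> measurable (intrinsic_ball X x r : set (borel R m)).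
  by move=> _; exact: ball_borel.
have := measure_fin_bigcup P (finite_seq s) disj mB.
rewrite -fsbig_seq// => sumE; rewrite -lee_fin.
have : (P (\bigcup_(x in [set` s]) intrinsic_ball X x r) <= 1)%E.
  by apply: probability_le1; apply: fin_bigcup_measurable => //; exact: finite_seq.
rewrite sumE; apply: le_trans.
have : forall s', {subset s' <= s} ->
    (((size s')%:R * Num.min (a * r `^ b) 1)%:E <=
     \sum_(x <- s') P (intrinsic_ball X x r))%E.
  elim=> [|x s' ih] ss'; first by rewrite big_nil mul0r.
  rewrite big_cons /= -natr1 mulrDl mul1r addrC EFinD leeD//.
    by apply: P_standard => //; apply: sX; apply: ss'; rewrite inE eqxx.
  by apply: ih => y ys'; apply: ss'; rewrite inE ys' orbT.
by apply.
Qed.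

(** Sizes of separated lists are bounded by [separated_size]; a list of maximal size is a net, since
    an uncovered point could be added to it. *)
Lemma separated_net (r : R) : 0 < r -> exists s, separated (r + r) s /\
  forall x, X x -> exists2 y, y \in s & (d y x <= (r + r)%:E)%E.
Proof.
move=> r0; set c := Num.min (a * r `^ b) 1.
have c0 : 0 < c by rewrite lt_min ltr01 mulr_gt0 ?powR_gt0.
pose Q n := `[< exists s, separated (r + r) s /\ size s = n >].
have exQ : exists n, Q n by exists 0%N; apply/asboolP; exists [::].
have bQ n : Q n -> (n <= Num.truncn c^-1)%N.
  move=> /asboolP[s [/(separated_size r0) sc <-]].
  rewrite -ltnS -(ltr_nat R); apply: le_lt_trans (truncnS_gt c^-1).
  by rewrite -[leRHS]mul1r ler_pdivlMr.
case: (ex_maxnP exQ bQ) => n /asboolP[s [ss sn]] nmax; exists s; split => //.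
move=> x Xx; apply: contrapT => nx.
have far y : y \in s -> ~ (d y x <= (r + r)%:E)%E by move=> ys yx; apply: nx; exists y.
have [us sX ssep] := ss.
suff /nmax : Q n.+1 by rewrite ltnn.
apply/asboolP; exists (x :: s); rewrite /= sn; split => //; split.
- rewrite /= us andbT; apply/negP => xs; apply: (far _ xs).
  by rewrite intrinsic_distxx// lee_fin addr_ge0// ltW.
- by move=> y; rewrite inE => /predU1P[->//|]; exact: sX.
- move=> y z; rewrite !inE => /predU1P[->|ys] /predU1P[->|zs] yz.
  + by move: yz; rewrite eqxx.
  + by rewrite intrinsic_dist_sym; exact: far.
  + exact: far.
  + exact: ssep.
Qed.

Context (dO : measure_display) (Omega : measurableType dO)
  (Pr : probability Omega R) (n : nat) (Xs : 'I_n -> Omega -> borel R m).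
Hypotheses (n_gt0 : (0 < n)%N) (Xs_iid : iid_sample Pr P Xs).

Definition misses x r : set Omega :=
  \bigcap_i (Xs i @^-1` (~` intrinsic_ball X x r)).

Lemma Xs_measurable i (B : set (borel R m)) :
  measurable B -> measurable (Xs i @^-1` B).
Proof. by have [mXs _ _] := Xs_iid; exact: preimageT_measurable. Qed.

Lemma misses_measurable x r : measurable (misses x r).
Proof.
apply: fin_bigcap_measurable => // i _; apply: Xs_measurable.
by apply: measurableC; exact: ball_borel.
Qed.

Lemma probability_misses x r :
  Pr (misses x r) = ((1 - fine (P (intrinsic_ball X x r))) ^+ n)%:E.
Proof.
have [_ XsP Xsi] := Xs_iid.
have mB := measurableC (ball_borel x r).
rewrite /misses Xsi// (eq_bigr (fun=> (1 - fine (P (intrinsic_ball X x r)))%:E)).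
  by rewrite prodEFin prodr_const card_ord.
move=> i _; rewrite XsP// (probability_setC P (ball_borel x r)) EFinB fineK//.
by apply: fin_num_measure; exact: ball_borel.
Qed.

Lemma fine_ball_ge x r : X x -> 0 < r ->
  Num.min (a * r `^ b) 1 <= fine (P (intrinsic_ball X x r)) <= 1.
Proof.
move=> Xx r0; have fP : P (intrinsic_ball X x r) \is a fin_num.
  by apply: fin_num_measure; exact: ball_borel.
rewrite -!lee_fin fineK// P_standard//= probability_le1//; exact: ball_borel.
Qed.

Lemma probability_misses_le x r : X x -> 0 < r ->
  (Pr (misses x r) <= (expR (- (a * r `^ b * n%:R)))%:E)%E.
Proof.
move=> Xx r0; rewrite probability_misses lee_fin.
have /andP[qc q1] := fine_ball_ge Xx r0.
set q := fine _ in qc q1 *; rewrite -mulNr expRM_natr.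
(* If the mass bound is below its cap, [1 - q <= exp (- q)] gives the estimate; otherwise the ball
   has full mass and the power is [0] because [n] is positive. *)
have [c1|c1] := leP (a * r `^ b) 1.
  rewrite lerXn2r ?nnegrE ?subr_ge0 ?expR_ge0//.
  apply: le_trans (expR_ge1Dx _); rewrite lerD2l lerN2.
  by move: qc; rewrite (min_idPl c1).
have -> : q = 1 by apply/eqP; rewrite eq_le q1; move: qc; rewrite (min_idPr (ltW c1)).
by rewrite subrr expr0n gtn_eqF//= exprn_ge0// expR_ge0.
Qed.

Lemma probability_misses0 x r : X x -> 0 < r -> 1 <= a * r `^ b ->
  Pr (misses x r) = 0%E.
Proof.
move=> Xx r0 c1; rewrite probability_misses.
have /andP[] := fine_ball_ge Xx r0; rewrite (min_idPr c1) => q1 q1'.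
have -> : fine (P (intrinsic_ball X x r)) = 1 by apply/eqP; rewrite eq_le q1'.
by rewrite subrr expr0n gtn_eqF.
Qed.

(** Union bound over the net of spacing [delta / 2]: a sample meeting every ball of radius
    [delta / 2] around the net is [delta]-dense. The null event of leaving [X] is discarded as
    well. *)
Lemma sample_cover (delta : R) : X !=set0 -> 0 < delta ->
  exists B : set Omega, [/\ measurable B,
    ((1 - alpha a b delta n)%:E <= Pr B)%E &
    forall w, B w -> (forall i, X (Xs i w)) /\
      forall z, X z -> exists i, (d (Xs i w) z <= delta%:E)%E].
Proof.
move=> [x0 Xx0] delta0.
have r0 : 0 < delta / 4 by rewrite divr_gt0.
have d2 : delta / 4 + delta / 4 = delta / 2 by field.
have d20 : 0 < delta / 2 by rewrite divr_gt0.
have [s] := separated_net r0; rewrite d2 => -[ss snet].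
have [us sX _] := ss.
have [rho rho0 Prho] := standard_full Xx0.
pose out i := Xs i @^-1` (~` intrinsic_ball X x0 rho).
have mout i : measurable (out i).
  by apply: Xs_measurable; apply: measurableC; exact: ball_borel.
have Pout i : Pr (out i) = 0%E.
  have [_ XsP _] := Xs_iid.
  rewrite /out XsP ?(probability_setC P (ball_borel _ _)) ?Prho ?subee//.
  by apply: measurableC; exact: ball_borel.
pose bad := (\big[setU/set0]_(i < n) out i) `|`
  (\big[setU/set0]_(y <- s) misses y (delta / 2)).
have mbad : measurable bad.
  apply: measurableU; apply: bigsetU_measurable => // y _.
  exact: misses_measurable.
have Pbad : (Pr bad <= (4 `^ b / (a * delta `^ b) *
    expR (- (a * (delta / 2) `^ b * n%:R)))%:E)%E.
  apply: le_trans (measureU2 _ _ _) _.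
  - exact: bigsetU_measurable.
  - by apply: bigsetU_measurable => y _; exact: misses_measurable.
  rewrite [X in (X + _ <= _)%E](_ : _ = 0%E) ?add0e; last first.
    apply/eqP; rewrite eq_le measure_ge0 andbT.
    have := measure_bigsetU_le Pr (index_enum 'I_n) mout.
    by rewrite [X in (_ <= X)%E]big1 => [|i _]; [exact|exact: Pout].
  apply: le_trans (measure_bigsetU_le _ _ _) _.
    by move=> y; exact: misses_measurable.
  (* When the balls of radius [delta / 2] have full mass, they are almost surely all met. Otherwise
     the cap is inactive at radius [delta / 4] too, and the net has at most
     [4 ^ b / (a * delta ^ b)] points. *)
  have [c1|/ltW c1] := leP (a * (delta / 2) `^ b) 1; last first.
    rewrite big_seq big1 => [|y ys]; last first.
      by apply: probability_misses0 => //; exact: sX.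
    by rewrite lee_fin mulr_ge0 ?expR_ge0// divr_ge0 ?powR_ge0// mulr_ge0 ?powR_ge0// ltW.
  set E := expR _.
  have : forall s', {subset s' <= s} ->
      (\sum_(y <- s') Pr (misses y (delta / 2)) <= ((size s')%:R * E)%:E)%E.
    elim=> [|y s' ih] ss'; first by rewrite big_nil mul0r.
    have -> : (size (y :: s'))%:R * E = E + (size s')%:R * E.
      by rewrite /= mulrSr addrC mulrDl mul1r.
    rewrite big_cons EFinD leeD//.
      by apply: probability_misses_le => //; apply: sX; apply: ss'; rewrite inE eqxx.
    by apply: ih => z zs'; apply: ss'; rewrite inE zs' orbT.
  move=> /(_ s (fun _ => id))/le_trans; apply; rewrite lee_fin.
  rewrite ler_wpM2r ?expR_ge0//.
  have c4 : a * (delta / 4) `^ b <= 1.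
    apply: le_trans c1; rewrite ler_pM2l//.
    apply: ge0_ler_powR; rewrite ?nnegrE; [exact: ltW|exact: ltW|exact: ltW|lra].
  have := @separated_size (delta / 4) s r0; rewrite d2 => /(_ ss).
  rewrite (min_idPl c4) powRM ?invr_ge0//; last exact: ltW.
  have e4 : 4 `^ b * 4^-1 `^ b = 1 :> R by rewrite -powRM// divff// powR1.
  rewrite ler_pdivlMr ?mulr_gt0 ?powR_gt0// => sle.
  have -> : (size s)%:R * (a * delta `^ b) =
      4 `^ b * ((size s)%:R * (a * (delta `^ b * 4^-1 `^ b))).
    rewrite -[LHS]mulr1 -[X in _ * X = _]e4.
    by move: (4 `^ b) (4^-1 `^ b) (delta `^ b) => q q' p; ring.
  by rewrite ler_piMr// powR_ge0.
exists (~` bad); split; first exact: measurableC.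
- rewrite probability_setC//.
  have fb : Pr bad \is a fin_num by exact: fin_num_measure.
  move: Pbad; rewrite -(fineK fb) -EFinB !lee_fin => Pbad.
  rewrite lerD2l lerN2 /alpha le_min Pbad andbT -lee_fin fineK//.
  exact: probability_le1.
- move=> w nbad.
  have inX i : X (Xs i w).
    suff xw : intrinsic_ball X x0 rho (Xs i w).
      exact: (intrinsic_dist_le_fin xw).2.
    apply: contrapT => nb; apply: nbad; left.
    by rewrite -bigcup_seq; exists i => //=; exact: mem_index_enum.
  split => // z Xz; have [y ys yz] := snet z Xz.
  have : ~ misses y (delta / 2) w.
    by move=> my; apply: nbad; right; rewrite -bigcup_seq; exists y.
  move=> /existsNP[i /not_implyP[_ /contrapT yi]]; exists i.
  apply: le_trans (intrinsic_dist_triangle geo_choice _ y _) _.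
  rewrite (intrinsic_dist_sym _ _ y) (splitr delta) EFinD.
  exact: leeD.
Qed.

End standard_measure.

(** * From a dense sample to the corollary *)

Section interleaving_bounds.
Context {R : realType} {m : nat} (X : set 'rV[R]_m).
Local Notation d := (intrinsic_dist X).

Lemma concave_mu_scale (f : 'rV[R]_m -> R) (omega : R -> R)
    (geo : 'rV[R]_m -> 'rV[R]_m -> R -> 'rV[R]_m) (delta : R) :
  intrinsic_finite X -> geodesic_choice X geo -> is_modulus X f omega ->
  concave_modulus omega -> 0 < delta ->
  (mu_scale X f omega geo delta <= (omega delta)%:E)%E.
Proof.
move=> X_finite geo_choice [omega0 omegaS omega00 f_omega] conc delta0.
rewrite /mu_scale ge_max lexx/=; apply: ge_ereal_sup => _ [[x y] /= [Xx Xy xy] <-].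
have /fineK dE := X_finite x y Xx Xy.
have D0 : 0 <= fine (d x y) by apply: fine_ge0; exact: intrinsic_dist_ge0.
move: xy; rewrite -dE lee_fin; set D := fine _ in D0 * => Ddelta.
rewrite ge_max; apply/andP; split.
  rewrite lee_fin.
  (* Concavity between [0] and [D] gives [omega D / 2 <= omega (D / 2)], and [D / 2 <= delta]. *)
  have := conc 0 D 2^-1 (lexx 0) D0; rewrite omega00 !mulr0 !add0r => /(_ _).
  have h : 0 <= 2^-1 :> R by lra.
  have h' : 2^-1 <= 1 :> R by lra.
  rewrite h h' => /(_ isT) cD.
  have : `|f x - f y| <= omega D by exact: f_omega.
  have : omega (2^-1 * D) <= omega delta by apply: omegaS; [exact: mulr_ge0|lra].
  move=> *; lra.
apply: ge_ereal_sup => _ [t t01' <-].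
move: t01'; rewrite /= in_itv/= => /andP[t0 t1].
rewrite lee_fin; set z := geo x y t.
have t01 : 0 <= t <= 1 by rewrite t0.
have Xz : X z by exact: (geodesic_in geo_choice).
have xz : `|f z - f x| <= omega (t * D).
  rewrite distrC; apply: le_trans (f_omega x z Xx Xz) _.
  apply: omegaS; first by apply: fine_ge0; exact: intrinsic_dist_ge0.
  rewrite -lee_fin EFinM fineK ?X_finite// /D dE.
  have := intrinsic_dist_geodesic geo_choice Xx Xy (lexx 0) t0 t1.
  by rewrite (geodesic0 geo_choice)// subr0.
have yz : `|f z - f y| <= omega ((1 - t) * D).
  apply: le_trans (f_omega z y Xz Xy) _.
  apply: omegaS; first by apply: fine_ge0; exact: intrinsic_dist_ge0.
  rewrite -lee_fin EFinM fineK ?X_finite// /D dE.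
  have := intrinsic_dist_geodesic geo_choice Xx Xy t0 t1 (lexx 1).
  by rewrite (geodesic1 geo_choice).
have -> : f z - ((1 - t) * f x + t * f y) =
    (1 - t) * (f z - f x) + t * (f z - f y) by ring.
have t1' : 0 <= 1 - t by lra.
apply: le_trans (ler_normD _ _) _; rewrite !normrM (ger0_norm t0) (ger0_norm t1').
(* Concavity bounds this average by [omega (2 * t * (1 - t) * D)], whose argument is at most [D / 2]
   and hence at most [delta]. *)
apply: (@le_trans _ _ ((1 - t) * omega (t * D) + t * omega ((1 - t) * D))).
  by apply: lerD; exact: ler_wpM2l.
apply: le_trans (conc _ _ _ (mulr_ge0 t0 D0) (mulr_ge0 t1' D0) t01) _.
have := mulr_ge0 t0 t1' => tt.
apply: omegaS; first by rewrite addr_ge0 ?mulr_ge0.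
have t4 : t * (1 - t) <= 4^-1 by have := sqr_ge0 (t - 2^-1); rewrite expr2; lra.
have := ler_wpM2r D0 t4; lra.
Qed.

Lemma interleaving_distance_reeb_le (f : 'rV[R]_m -> R) (omega : R -> R)
    (geo : 'rV[R]_m -> 'rV[R]_m -> R -> 'rV[R]_m) (delta : R) (S : set 'rV[R]_m) :
  intrinsic_finite X -> geodesic_choice X geo -> intrinsic_compact X ->
  constructible (restr X f) -> is_modulus X f omega -> 0 < delta ->
  finite_set S -> S `<=` X ->
  (forall z, X z -> exists2 s, S s & (d s z <= delta%:E)%E) ->
  (interleaving_distance (pi0_cosheaf (@reeb_fun R X (restr X f)))
     (pl_reeb X delta S f) <= mu_scale X f omega geo delta)%E.
Proof.
move=> X_finite geo_choice X_compact Xf [omega0 omegaS omega00 f_omega] delta0.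
move=> S_finite SX S_cover.
have mu_ge : ((omega delta)%:E <= mu_scale X f omega geo delta)%E.
  by rewrite /mu_scale le_max lexx.
have mu0 : (0 <= mu_scale X f omega geo delta)%E.
  by apply: le_trans mu_ge; rewrite lee_fin omega0// ltW.
(* The supremum in [theta] is taken in the extended reals; an infinite scale makes the bound
   trivial, and a finite one is itself the interleaving shift. *)
have [->|mu_oo] := eqVneq (mu_scale X f omega geo delta) +oo%E; first exact: leey.
have muE : (fine (mu_scale X f omega geo delta))%:E = mu_scale X f omega geo delta.
  by rewrite fineK// ge0_fin_numE// ltey.
have e0 : 0 <= fine (mu_scale X f omega geo delta) by exact: fine_ge0.
have le_mu x y : X x -> X y -> (d x y <= (2 * delta)%:E)%E ->
    (Order.max (2^-1 * `|f x - f y|)%:E (affine_defect f (geo x y) x y) <=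
     mu_scale X f omega geo delta)%E.
  move=> Xx Xy xy; rewrite [leRHS]/mu_scale le_max; apply/orP; right.
  by apply: ereal_sup_ubound; exists (x, y).
rewrite -[leRHS]muE; apply: ereal_inf_lbound; exists (NngNum e0) => //=.
apply: (reeb_interleaved X_finite geo_choice) => //=.
- move=> x y Xx Xy xy; rewrite -lee_fin muE; apply: le_trans mu_ge.
  rewrite lee_fin (le_trans (f_omega x y Xx Xy))//; apply: omegaS.
    by apply: fine_ge0; exact: intrinsic_dist_ge0.
  by rewrite -lee_fin fineK// X_finite.
- move=> x y Xx Xy xy; rewrite -lee_fin muE.
  by apply: le_trans (le_mu x y Xx Xy xy); rewrite le_max lexx.
- move=> x y t Xx Xy xy t01; rewrite -lee_fin muE.
  apply: le_trans (le_mu x y Xx Xy xy); rewrite le_max; apply/orP; right.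
  by apply: ereal_sup_ubound; exists t => //=; rewrite in_itv.
Qed.

End interleaving_bounds.

Theorem corollary5p1 (R : realType) (m : nat) (X : set 'rV[R]_m)
    (f : 'rV[R]_m -> R) (omega : R -> R)
    (geo : 'rV[R]_m -> 'rV[R]_m -> R -> 'rV[R]_m)
    (X_compact : compact X)
    (X_finite : intrinsic_finite X)
    (f_continuous : {within X, continuous f})
    (Xf_constructible : constructible (restr X f))
    (omega_modulus : is_modulus X f omega)
    (geo_choice : geodesic_choice X geo)
    (P : probability (borel R m) R)
    (P_support : msupport P = X)
    (X_intrinsic_compact : intrinsic_compact X)
    (a b : R) (a_gt0 : 0 < a) (b_gt0 : 0 < b)
    (P_standard : standard X P a b)
    (d : measure_display) (Omega : measurableType d) (Pr : probability Omega R)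
    (n : nat) (n_gt0 : (0 < n)%N) (Xs : 'I_n -> Omega -> borel R m)
    (Xs_iid : iid_sample Pr P Xs) :
  let F_R := pi0_cosheaf (@reeb_fun R X (restr X f)) in
  let estimator delta w := pl_reeb X delta (range (Xs ^~ w)) f in
  let bound delta (r : \bar R) :=
    ((1 - alpha a b delta n)%:E <=
     inner_prob Pr
       [set w | (interleaving_distance F_R (estimator delta w) <= r)%E])%E in
  [/\ forall delta, 0 < delta -> bound delta (mu_scale X f omega geo delta),
      concave_modulus omega -> omega 0 = 0 ->
        forall delta, 0 < delta -> bound delta (omega delta)%:E &
      intrinsic_lipschitz1 X f ->
        forall delta, 0 < delta -> bound delta delta%:E].
Proof.
move=> F_R estimator bound.
have X_nonempty : X !=set0 by rewrite -P_support; exact: msupport_nonempty.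
(* The modulus [om] is left free so that the Lipschitz case can use the identity. The measurable
   event of [sample_cover] bounds the inner probability from below. *)
have main om delta (r : \bar R) : is_modulus X f om -> 0 < delta ->
    (mu_scale X f om geo delta <= r)%E -> bound delta r.
  move=> om_mod delta0 mu_r.
  have [B [mB PB BP]] := sample_cover X_finite geo_choice X_intrinsic_compact
    a_gt0 b_gt0 P_standard n_gt0 Xs_iid X_nonempty delta0.
  apply: le_trans PB _; apply: ereal_sup_ubound; exists B => //; split => // w Bw.
  have [inX cover] := BP w Bw; apply: le_trans mu_r.
  apply: interleaving_distance_reeb_le => //.
  - exact: finite_image.
  - by move=> _ [i _ <-].
  - by move=> z /cover[i iz]; exists (Xs i w).
split.
- by move=> delta delta0; exact: main omega_modulus delta0 _.
- move=> conc _ delta delta0; apply: main (omega_modulus) (delta0) _.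
  exact: concave_mu_scale omega_modulus conc delta0.
- move=> lip delta delta0.
  (* For a 1-Lipschitz [f] the identity is a concave modulus, with value [delta] at [delta]. *)
  have id_mod : is_modulus X f id.
    split => // x y Xx Xy; rewrite -lee_fin fineK ?X_finite//; exact: lip.
  by apply: main (id_mod) (delta0) _; apply: concave_mu_scale.
Qed.
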